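(* Let $X=\{0,1,2,3,4\}$ be the affine crossed set $(\mathbb Z_5,\triangleright^2)$, i.e. $i\triangleright j=2j-i$ in $\mathbb Z/5$, and let $V=\mathbb CX$ be the braided vector space with braiding $i\otimes j\mapsto-(2j-i)\otimes i$ (associated with the constant cocycle $-1$; here $2j-i$ denotes the basis element of $V$ indexed by $2j-i\in\mathbb Z/5$). The Nichols algebra $\mathfrak B(V)$ can be presented by generators $\{0,1,2,3,4\}$ with defining relations (juxtaposition denotes the product of generators) $$\begin{aligned}&0^2,\ 1^2,\ 2^2,\ 3^2,\ 4^2,\\&32+20+13+01,\quad 40+21+14+02,\quad 41+34+10+03,\\&42+30+23+04,\quad 43+31+24+12,\\&1010+0101.\end{aligned}$$ A basis of $\mathfrak B(V)$ is obtained by choosing one element in each of the following rows and juxtaposing (multiplying) them from top to bottom ($e$ is the unit element of the algebra): $$\begin{aligned}&(e,0)\\&(e,1,10,101)\\&(e,2,21,212,20,201,2012,2010,20102,201020)\\&(e,3,31,312,30,303,3031,30312)\\&(e,4)\end{aligned}$$ Its Hilbert polynomial is $$\begin{aligned}P(t)&=(1+t)^2(1+t+t^2+t^3)(1+t+2t^2+2t^3+2t^4+t^5+t^6)(1+t+2t^2+2t^3+t^4+t^5)\\&=t^{16}+5t^{15}+15t^{14}+35t^{13}+66t^{12}+105t^{11}+145t^{10}+175t^9+186t^8+175t^7\\&\quad+145t^6+105t^5+66t^4+35t^3+15t^2+5t+1.\end{aligned}$$ Its dimension is $1280$. Its top degree is $16$. An integral is given by $0101201020303124$.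
   Context: Nichols algebra of a braided vector space $(V,c)$: let the braid group $\mathbb B_n$ (generators $\sigma_i$) act on $V^{\otimes n}$, $\sigma_i$ by the braiding in positions $i,i+1$; for $x\in\mathbb S_n$ with shortest expression $x=\tau_{i_1}\cdots\tau_{i_l}$ in elementary transpositions put $M(x)=\sigma_{i_1}\cdots\sigma_{i_l}$; $Q_n=\sum_{x\in\mathbb S_n}M(x)$; then $\mathfrak B(V)=\mathbb C\oplus V\oplus\bigoplus_{n\ge2}V^{\otimes n}/\ker Q_n$, a graded braided Hopf algebra. The symbols $0,\dots,4$ denote the basis vectors of $V$ (in particular $0$ is a generator, not the zero vector). The top degree is the largest degree in which $\mathfrak B(V)$ is non-zero; the space of integrals is the one-dimensional homogeneous component of top degree, and ''an integral'' means a non-zero element of it. *)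

(* Defs.v *)
From HB Require Import structures.
From mathcomp Require Import all_boot all_order all_fingroup all_algebra.
From mathcomp Require Import zify ring.
From mathcomp Require Import finmap boolp reals complex monalg.

Set Implicit Arguments.
Unset Strict Implicit.
Unset Printing Implicit Defensive.

Import GRing.Theory.

Local Open Scope ring_scope.
Local Open Scope quotient_scope.

(** * Shortest expressions in the symmetric group *)

Section ReducedWords.
Variable n : nat.
Implicit Types (i j : 'I_n.-1) (w : seq 'I_n.-1) (x : 'S_n).

Lemma ord_succ_subproof i : (i.+1 < n)%N.
Proof. by case: n i => [|m] []. Qed.

Definition ord_fst i : 'I_n := widen_ord (leq_pred n) i.
Definition ord_snd i : 'I_n := Ordinal (ord_succ_subproof i).

(* The elementary transposition of the positions i and i + 1, from 0. *)
Definition tau i : 'S_n := tperm (ord_fst i) (ord_snd i).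

Definition expr w : 'S_n := (\prod_(i <- w) tau i)%g.

(* Inversion numbers only serve to establish that shortest expressions exist
   and have the expected properties. *)
Definition inversions x : nat :=
  \sum_(k < n) \sum_(l < n) ((k < l) && (x l < x k))%N.

Let invset x := [set p : 'I_n * 'I_n | (p.1 < p.2)%N && (x p.2 < x p.1)%N].

Lemma inversionsE x : inversions x = #|invset x|.
Proof.
rewrite /inversions pair_big /= -sum1_card [RHS]big_mkcond /=.
by apply: eq_bigr => -[k l] _; rewrite inE /=; case: ifP.
Qed.

Lemma tauK i x : (tau i * (tau i * x))%g = x.
Proof. by rewrite mulgA tperm2 mul1g. Qed.

Lemma tau_fst i x : (tau i * x)%g (ord_fst i) = x (ord_snd i).
Proof. by rewrite permM tpermL. Qed.

Lemma tau_snd i x : (tau i * x)%g (ord_snd i) = x (ord_fst i).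
Proof. by rewrite permM tpermR. Qed.

Lemma tau_neq i x (k : 'I_n) :
  k != i :> nat -> k != i.+1 :> nat -> (tau i * x)%g k = x k.
Proof.
move=> ki ki1; rewrite permM tpermD //.
  by apply: contra_neq ki => <-.
by apply: contra_neq ki1 => <-.
Qed.

Lemma tau_val i (k : 'I_n) :
  tau i k = (if k == i :> nat then i.+1 else if k == i.+1 :> nat then i : nat
             else k) :> nat.
Proof.
rewrite /tau; case: tpermP => [->|->|] /=; rewrite ?eqxx //=.
  by rewrite (gtn_eqF (ltnSn i)).
move=> /eqP h1 /eqP h2.
have -> : (k == i :> nat) = false.
  by apply/negbTE; apply: contraNN h1 => /eqP h; apply/eqP/val_inj.
have -> // : (k == i.+1 :> nat) = false.
by apply/negbTE; apply: contraNN h2 => /eqP h; apply/eqP/val_inj.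
Qed.

Lemma tau_ltn i (k l : 'I_n) : (k, l) != (ord_fst i, ord_snd i) ->
  (k < l)%N -> (tau i k < tau i l)%N.
Proof.
move=> neq kl; rewrite !tau_val.
have {}neq : ~~ ((k == i :> nat) && (l == i.+1 :> nat)).
  apply: contraNN neq => /andP[/eqP h1 /eqP h2]; rewrite xpair_eqE.
  by apply/andP; split; apply/eqP/val_inj.
by do !case: eqP => //=; lia.
Qed.

Lemma inversions_desc i x : (x (ord_snd i) < x (ord_fst i))%N ->
  inversions x = (inversions (tau i * x)%g).+1.
Proof.
move=> des; rewrite !inversionsE; set p0 := (ord_fst i, ord_snd i).
have p0x : p0 \in invset x by rewrite inE /= ltnSn.
have p0y : p0 \notin invset (tau i * x)%g.
  by rewrite inE /= ltnSn /= tau_fst tau_snd -leqNgt ltnW.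
rewrite (cardsD1 p0) p0x add1n; congr _.+1.
pose phi (p : 'I_n * 'I_n) := (tau i p.1, tau i p.2).
have phiK : involutive phi by case=> k l; rewrite /phi /= !tpermK.
have phi0 p : phi p = p0 -> (p.1 < p.2)%N = false.
  move=> h; have := phiK p; rewrite h => <-.
  by rewrite /phi /= tpermL tpermR /= ltnNge leqnSn.
rewrite -(card_imset _ (inv_inj phiK)); apply: eq_card => p.
apply/imsetP/idP => [[q qx ->]|].
  move: qx; rewrite !inE => /and3P[qp0 q1 q2].
  by rewrite !permM !tpermK q2 andbT tau_ltn // -surjective_pairing.
move=> py; exists (phi p); last by rewrite phiK.
have pp0 : p != p0 by apply: contraNneq p0y => <-.
move: py; rewrite !inE !permM /= => /andP[p1 ->]; rewrite andbT.
rewrite tau_ltn -?surjective_pairing // andbT.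
by apply/eqP => /phi0; rewrite p1.
Qed.

Lemma inversions_asc i x : ~~ (x (ord_snd i) < x (ord_fst i))%N ->
  inversions (tau i * x)%g = (inversions x).+1.
Proof.
rewrite -leqNgt => asc; rewrite -[in RHS](tauK i x); apply: inversions_desc.
rewrite tau_fst tau_snd ltn_neqAle asc andbT.
apply/eqP => /val_inj/perm_inj /(congr1 val) /= h.
by lia.
Qed.

Lemma inversions1 : inversions 1 = 0%N.
Proof.
rewrite /inversions big1 // => k _; rewrite big1 // => l _.
by rewrite !perm1; case: ltngtP.
Qed.

Lemma expr_cons i w : expr (i :: w) = (tau i * expr w)%g.
Proof. by rewrite /expr big_cons. Qed.

Lemma expr_cat w1 w2 : expr (w1 ++ w2) = (expr w1 * expr w2)%g.
Proof. by rewrite /expr big_cat. Qed.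

Lemma inversions_expr w : (inversions (expr w) <= size w)%N.
Proof.
elim: w => [|i w IHw]; first by rewrite /expr big_nil inversions1.
rewrite expr_cons /=.
have [/inversions_desc h|/inversions_asc -> //] :=
  boolP (expr w (ord_snd i) < expr w (ord_fst i))%N.
by apply: leq_trans (leqnSn _); apply: leq_trans IHw; rewrite h leqnSn.
Qed.

Lemma no_desc x :
  (forall i, ~~ (x (ord_snd i) < x (ord_fst i))%N) -> x = 1%g.
Proof.
move=> asc; have step (k l : 'I_n) : l = k.+1 :> nat -> (x k < x l)%N.
  move=> lk; have kn : (k < n.-1)%N by have := ltn_ord l; lia.
  have := asc (Ordinal kn).
  have -> : ord_fst (Ordinal kn) = k by apply: val_inj.
  have -> : ord_snd (Ordinal kn) = l by apply: val_inj.
  rewrite -leqNgt leq_eqVlt => /orP[/eqP/val_inj/perm_inj h|//].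
  by move: lk; rewrite h; lia.
have ge (k : 'I_n) : (k <= x k)%N.
  case: k; elim=> // k IHk kn; have kn' := ltnW kn.
  exact: leq_ltn_trans (IHk kn') (step (Ordinal kn') (Ordinal kn) _).
have le (k : 'I_n) : ((x^-1)%g k <= k)%N by have := ge ((x^-1)%g k); rewrite permKV.
suff fixed m : forall k : 'I_n, (k < m)%N -> x k = k.
  by apply/permP => k; rewrite perm1 (fixed n).
elim: m => // m IHm k; rewrite ltnS leq_eqVlt => /orP[/eqP km|/IHm //].
have := le k; rewrite leq_eqVlt => /orP[/eqP/val_inj h|].
  by rewrite -[in LHS]h permKV.
by move=> /[dup] lt; rewrite [X in (_ < X)%N]km => /IHm; rewrite permKV => h;
  move: lt; rewrite -h ltnn.
Qed.

Lemma reduced_exists x : exists2 w, size w = inversions x & expr w = x.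
Proof.
move: {2}(inversions x) (leqnn (inversions x)) => m.
elim: m x => [|m IHm] x lex.
  exists [::]; first by apply/esym/eqP; rewrite -leqn0.
  rewrite /expr big_nil; apply/esym/no_desc => i.
  by apply/negP => /inversions_desc h; rewrite h in lex.
case: (pickP (fun i => x (ord_snd i) < x (ord_fst i))%N) => [i des|asc].
  have h := inversions_desc des; rewrite h ltnS in lex.
  have [w sw ew] := IHm _ lex.
  by exists (i :: w); rewrite ?expr_cons /= ?sw ?h // ew tauK.
have x1 : x = 1%g by apply: no_desc => i; rewrite asc.
by exists [::]; rewrite x1 ?inversions1 // /expr big_nil.
Qed.

Lemma expr_len_subproof x :
  exists l, [exists w : l.-tuple 'I_n.-1, expr w == x].
Proof.
have [w _ ew] := reduced_exists x; exists (size w).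
by apply/existsP; exists (in_tuple w); apply/eqP.
Qed.

(* The least length of an expression of x. *)
Definition expr_len x := ex_minn (expr_len_subproof x).

Lemma shortest_subproof x :
  exists w : (expr_len x).-tuple 'I_n.-1, expr w == x.
Proof. by rewrite /expr_len; case: ex_minnP => l /existsP. Qed.

(* A chosen shortest expression; by [matsumoto] below, the choice does not
   affect the action of the braid group. *)
Definition shortest x : seq 'I_n.-1 := xchoose (shortest_subproof x).

Lemma expr_shortest x : expr (shortest x) = x.
Proof. exact/eqP/(xchooseP (shortest_subproof x)). Qed.

Lemma size_shortest x : size (shortest x) = inversions x.
Proof.
rewrite size_tuple; apply/eqP; rewrite eqn_leq; apply/andP; split.
  rewrite /expr_len; case: ex_minnP => l _; apply.
  have [w sw ew] := reduced_exists x; rewrite -sw.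
  by apply/existsP; exists (in_tuple w); apply/eqP.
rewrite -{1}(expr_shortest x).
by apply: leq_trans (inversions_expr _) _; rewrite size_tuple.
Qed.

Lemma shortest_min w : (size (shortest (expr w)) <= size w)%N.
Proof. by rewrite size_shortest inversions_expr. Qed.

Definition reduced w := size w == inversions (expr w).

Lemma reduced_shortest x : reduced (shortest x).
Proof. by rewrite /reduced expr_shortest size_shortest. Qed.

Lemma reduced_cons i w : reduced (i :: w) ->
  let x := expr (i :: w) in (x (ord_snd i) < x (ord_fst i))%N /\ reduced w.
Proof.
rewrite /reduced expr_cons /= => /eqP h; have le := inversions_expr w.
have [/inversions_desc e|] := boolP (expr w (ord_snd i) < expr w (ord_fst i))%N.
  by move: le; rewrite e -h; lia.
move=> asc; have e := inversions_asc asc; split; last by move: h; rewrite e => -[->].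
rewrite tau_fst tau_snd ltn_neqAle leqNgt asc andbT.
apply/eqP => /val_inj/perm_inj /(congr1 val) /= k.
by lia.
Qed.

Lemma reduced_desc i w : (expr w (ord_fst i) < expr w (ord_snd i))%N ->
  reduced w -> reduced (i :: w).
Proof.
move=> asc /eqP h; rewrite /reduced expr_cons /= inversions_asc ?h //.
by rewrite -leqNgt ltnW.
Qed.

Lemma tau_comm i j x : (i.+1 < j)%N ->
  (tau i * (tau j * x) = tau j * (tau i * x))%g.
Proof.
move=> ij; rewrite !mulgA; congr (_ * _)%g; apply/permP => k; apply: val_inj.
by rewrite /= !permM !tau_val; do !case: eqP => //=; lia.
Qed.

Lemma tau_braid i j x : j = i.+1 :> nat ->
  (tau i * (tau j * (tau i * x)) = tau j * (tau i * (tau j * x)))%g.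
Proof.
move=> ij; rewrite !mulgA; congr (_ * _)%g; apply/permP => k; apply: val_inj.
by rewrite /= !permM !tau_val; do !case: eqP => //=; lia.
Qed.

Section Matsumoto.
Variables (E : Type) (D : E -> Prop) (act : nat -> E -> E).
Hypothesis actD : forall i t, D t -> D (act i t).
Hypothesis act_comm : forall i j t, (i.+1 < j)%N -> (j.+1 < n)%N -> D t ->
  act i (act j t) = act j (act i t).
Hypothesis act_braid : forall i t, (i.+2 < n)%N -> D t ->
  act i (act i.+1 (act i t)) = act i.+1 (act i (act i.+1 t)).

Definition word_act w t := foldr (fun i => act (i : 'I_n.-1)) t w.

Lemma word_act_cat w1 w2 t :
  word_act (w1 ++ w2) t = word_act w1 (word_act w2 t).
Proof. by rewrite /word_act foldr_cat. Qed.

Lemma word_actD w t : D t -> D (word_act w t).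
Proof. by move=> Dt; elim: w => //= i w; apply: actD. Qed.

Lemma matsumoto w w' t : reduced w -> reduced w' -> expr w = expr w' -> D t ->
  word_act w t = word_act w' t.
Proof.
move=> rw rw' eww' Dt; move: {2}(size w) (leqnn (size w)) => m.
elim: m w w' rw rw' eww' => [|m IHm] w w' rw rw' eww' sw.
  have sw' : size w = size w' by rewrite (eqP rw) (eqP rw') eww'.
  by move: w w' sw sw' {rw rw' eww'} => [|//] [|//].
case: w w' rw rw' eww' sw => [|i u] [|j u'] // rw rw' eww' sw;
  try by move: rw rw'; rewrite /reduced eww' => /eqP <-.
have {rw} [di ru] := reduced_cons rw.
have {rw'} [dj ru'] := reduced_cons rw'.
rewrite -eww' in dj; set x := expr (i :: u) in di dj eww'.
have eu : expr u = (tau i * x)%g by rewrite /x expr_cons tauK.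
have eu' : expr u' = (tau j * x)%g by rewrite eww' expr_cons tauK.
have {}sw : (size u <= m)%N by [].
have sw' : (size u' <= m)%N.
  have := inversions_desc di; rewrite (inversions_desc dj) -eu -eu'.
  by rewrite -(eqP ru) -(eqP ru') => -[->].
move: x eu eu' di dj {eww'} => x.
wlog ij : i j u u' ru ru' sw sw' / (i <= j)%N => [wl eu eu' di dj|].
  have [/wl h|/ltnW/wl h] := leqP i j; first exact: h.
  exact/esym/h.
move=> eu eu' di dj /=.
have [ij1|ij1|/eqP ij1] := ltngtP i.+1 j.
- set y := (tau j * (tau i * x))%g; set v := shortest y.
  have rv : reduced v := reduced_shortest y.
  have ev : expr v = y := expr_shortest y.
  have eji : expr (j :: v) = expr u by rewrite expr_cons ev tauK eu.
  have eij : expr (i :: v) = expr u'.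
    by rewrite expr_cons ev /y -(tau_comm x ij1) tauK eu'.
  have xj : (tau i * x)%g (ord_fst j) = x (ord_fst j) /\
      (tau i * x)%g (ord_snd j) = x (ord_snd j).
    by split; apply: tau_neq => /=; lia.
  have xi : (tau j * x)%g (ord_fst i) = x (ord_fst i) /\
      (tau j * x)%g (ord_snd i) = x (ord_snd i).
    by split; apply: tau_neq => /=; lia.
  have rj : reduced (j :: v).
    by apply: reduced_desc => //; rewrite ev tau_fst tau_snd xj.1 xj.2.
  have ri : reduced (i :: v).
    apply: reduced_desc => //.
    by rewrite ev /y -(tau_comm x ij1) tau_fst tau_snd xi.1 xi.2.
  rewrite (IHm u (j :: v)) // (IHm u' (i :: v)) //=.
  by apply: act_comm; rewrite ?ord_succ_subproof //; apply: word_actD.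
- have {ij1 ij} ij : i = j by apply: val_inj => /=; lia.
  subst j; congr (act i _); apply: IHm => //.
  by rewrite eu eu'.
- have {}ij1 : j = i.+1 :> nat by apply/esym/eqP.
  set y := (tau i * (tau j * (tau i * x)))%g; set v := shortest y.
  have rv : reduced v := reduced_shortest y.
  have ev : expr v = y := expr_shortest y.
  have eu2 : expr (j :: i :: v) = expr u by rewrite !expr_cons ev !tauK eu.
  have eu2' : expr (i :: j :: v) = expr u'.
    by rewrite !expr_cons ev /y (tau_braid _ ij1) !tauK eu'.
  have eij : ord_snd i = ord_fst j by apply: val_inj => /=; lia.
  have ji : (tau j * (tau i * x))%g (ord_fst i) = x (ord_fst j).
    by rewrite tau_neq /=; [rewrite tau_fst eij | lia..].
  have jj : (tau i * x)%g (ord_snd j) = x (ord_snd j).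
    by rewrite tau_neq //=; lia.
  have ii : (tau j * x)%g (ord_fst i) = x (ord_fst i).
    by rewrite tau_neq //=; lia.
  have rj : reduced (j :: i :: v).
    apply: reduced_desc; last apply: reduced_desc => //.
      rewrite expr_cons ev tauK tau_fst tau_snd jj -eij tau_snd.
      by rewrite eij in di; apply: ltn_trans dj _; rewrite -eij eij.
    by rewrite ev tau_fst tau_snd ji eij tau_fst jj.
  have ri : reduced (i :: j :: v).
    apply: reduced_desc; last apply: reduced_desc => //.
      rewrite expr_cons ev /y (tau_braid _ ij1) tauK tau_fst tau_snd ii eij tau_fst.
      by rewrite eij in di; apply: ltn_trans dj _.
    rewrite ev /y (tau_braid _ ij1) tau_fst tau_snd -eij tau_snd ii.
    rewrite tau_neq /=; [rewrite tau_snd -eij // | lia..].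
  rewrite (IHm u (j :: i :: v)) // (IHm u' (i :: j :: v)) //=.
  by rewrite ij1; apply: act_braid (word_actD _ Dt); rewrite -ij1 ord_succ_subproof.
Qed.

End Matsumoto.
End ReducedWords.

Section LiftWords.
Variable n : nat.
Implicit Types (j : 'I_n.+1) (z : 'S_n) (w : seq 'I_n.-1).

Let widen w : seq 'I_n.+1.-1 := map (@ord_fst n) w.
Let shift w : seq 'I_n.+1.-1 := map (@ord_snd n) w.

Lemma ltn_lift j (k l : 'I_n) : (lift j k < lift j l)%N = (k < l)%N.
Proof. by rewrite /= /bump; case: leqP; case: leqP => /=; lia. Qed.

Lemma inversions_lift_max j z : inversions (lift_perm j ord_max z) =
  (inversions (lift_perm j ord_max 1%g) + inversions z)%N.
Proof.
suff [C h] : exists C, forall z, inversions (lift_perm j ord_max z) =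
    (C + inversions z)%N by rewrite !h inversions1 addn0.
exists (\sum_(k < n) (j < lift j k)%N)%N => {}z.
rewrite /inversions (bigD1_ord j) //=; congr (_ + _)%N.
  rewrite (bigD1_ord j) //= ltnn add0n; apply: eq_bigr => k _.
  by rewrite lift_perm_id lift_perm_lift lift_max /= ltn_ord andbT.
apply: eq_bigr => k _; rewrite (bigD1_ord j) //= lift_perm_id !lift_perm_lift.
have -> : ((ord_max : 'I_n.+1) < lift ord_max (z k))%N = false.
  by rewrite lift_max /= ltnNge ltnW.
rewrite andbF add0n.
by apply: eq_bigr => l _; rewrite !lift_perm_lift !ltn_lift.
Qed.

Lemma inversions_lift0 j z : inversions (lift_perm j ord0 z) =
  (inversions (lift_perm j ord0 1%g) + inversions z)%N.
Proof.
suff [C h] : exists C, forall z, inversions (lift_perm j ord0 z) =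
    (C + inversions z)%N by rewrite !h inversions1 addn0.
exists (\sum_(k < n) (lift j k < j)%N)%N => {}z.
rewrite /inversions (bigD1_ord j) //= big1 ?add0n => [|k _]; last first.
  by rewrite lift_perm_id ltn0 andbF.
rewrite -big_split; apply: eq_bigr => k _ /=.
rewrite (bigD1_ord j) //= lift_perm_id lift_perm_lift lift0 andbT.
by congr (_ + _)%N; apply: eq_bigr => l _; rewrite !lift_perm_lift !ltn_lift.
Qed.

Lemma tau_widen (i : 'I_n.-1) :
  @tau n.+1 (ord_fst i) = lift_perm ord_max ord_max (tau i).
Proof.
apply/permP => k; apply: val_inj; rewrite /= tau_val /=.
case: (unliftP ord_max k) => [l|] ->.
  by rewrite lift_perm_lift !lift_max tau_val.
by rewrite lift_perm_id /=; have := ltn_ord i; do !case: eqP => //; lia.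
Qed.

Lemma tau_shift (i : 'I_n.-1) :
  @tau n.+1 (ord_snd i) = lift_perm ord0 ord0 (tau i).
Proof.
apply/permP => k; apply: val_inj; rewrite /= tau_val /=.
case: (unliftP ord0 k) => [l|] ->; last by rewrite lift_perm_id.
by rewrite lift_perm_lift !lift0 tau_val !eqSS; do !case: eqP.
Qed.

Lemma expr_widen w : expr (widen w) = lift_perm ord_max ord_max (expr w).
Proof.
elim: w => [|i w IHw]; first by rewrite /expr !big_nil lift_perm1.
by rewrite /= !expr_cons IHw tau_widen lift_permM.
Qed.

Lemma expr_shift w : expr (shift w) = lift_perm ord0 ord0 (expr w).
Proof.
elim: w => [|i w IHw]; first by rewrite /expr !big_nil lift_perm1.
by rewrite /= !expr_cons IHw tau_shift lift_permM.
Qed.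

Lemma reduced_widen j z :
  let w := shortest (lift_perm j ord_max 1%g) ++ widen (shortest z) in
  reduced w /\ expr w = lift_perm j ord_max z.
Proof.
move=> w; have ew : expr w = lift_perm j ord_max z.
  by rewrite expr_cat expr_widen !expr_shortest lift_permM mul1g.
by rewrite /reduced ew size_cat size_map !size_shortest -inversions_lift_max.
Qed.

Lemma reduced_shift j z :
  let w := shortest (lift_perm j ord0 1%g) ++ shift (shortest z) in
  reduced w /\ expr w = lift_perm j ord0 z.
Proof.
move=> w; have ew : expr w = lift_perm j ord0 z.
  by rewrite expr_cat expr_shift !expr_shortest lift_permM mul1g.
by rewrite /reduced ew size_cat size_map !size_shortest -inversions_lift0.
Qed.

Lemma sum_lift_perm (V : nmodType) (F : 'S_n.+1 -> V) (k : 'I_n.+1) :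
  \sum_x F x = \sum_j \sum_(z : 'S_n) F (lift_perm j k z).
Proof.
rewrite pair_bigA /= (reindex (fun p => lift_perm p.1 k p.2)) //.
apply/onW_bij/inj_card_bij; last first.
  by rewrite card_prod !card_Sn card_ord factS.
move=> [j z] [j' z'] /= h.
have jj : j = j'.
  apply: (@perm_inj _ (lift_perm j k z)); rewrite lift_perm_id h.
  by rewrite lift_perm_id.
subst j'; congr pair; apply/permP => l; apply: (@lift_inj _ k).
by rewrite -!(lift_perm_lift j) h.
Qed.

End LiftWords.

(** * The tensor algebra, and linear algebra in coordinates *)

Lemma malg_scalerAr (K : comNzRingType) (M : monomType) (a : K)
  (t u : {malg K[M]}) : a *: (t * u) = t * (a *: u).
Proof.
have comm : t * a%:MP = a%:MP * t.
  rewrite !malgM_def fgmulgU fgmulUg; apply: eq_bigr => k _.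
  by rewrite mulm1 mul1m mulrC.
by rewrite -!mul_malgC !mulrA comm.
Qed.

Lemma malg_sumE (K : nzRingType) (M : choiceType) (t : {malg K[M]}) :
  t = \sum_(m <- msupp t) t@_m *: << m >>.
Proof.
rewrite {1}[t]monalgE; apply: eq_bigr => m _; apply/malgP => k.
by rewrite mcoeffZ !mcoeffU mulr_natr.
Qed.

(* The tensor algebra of the vector space with basis X, that is, the free
   algebra on X: the words in X form a basis, and those of size n are the
   standard basis of the n-th tensor power. *)
Definition tensor (K : fieldType) (X : choiceType) := {malg K[{fmonom X}]}.

HB.instance Definition _ K X := GRing.Lmodule.on (tensor K X).

(* The locks below are for performance only. *)
HB.lock Definition word (K : fieldType) (X : choiceType) (s : seq X) :
  tensor K X := << FMonom s >>.

Arguments word K {X} s.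

HB.lock Definition tensor_mul (K : fieldType) (X : choiceType)
  (t u : {malg K[{fmonom X}]}) : {malg K[{fmonom X}]} := t * u.

(* Linear extension of a map defined on words. *)
HB.lock Definition linext (K : fieldType) (X : choiceType) (W : lmodType K)
  (f : seq X -> W) (t : tensor K X) : W := \sum_(m <- msupp t) t@_m *: f m.

Section TensorRing.
Variables (K : fieldType) (X : choiceType).
Local Notation T := (tensor K X).
Local Notation mulT := (@tensor_mul K X : T -> T -> T).
Local Notation A := {malg K[{fmonom X}]}.

Fact tensor_mulA : associative mulT.
Proof. by rewrite tensor_mul.unlock => t u v; apply: (@mulrA A). Qed.
Fact tensor_mul1 : left_id (1 : A) mulT.
Proof. by rewrite tensor_mul.unlock => t; apply: (@mul1r A). Qed.
Fact tensor_mulr1 : right_id (1 : A) mulT.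
Proof. by rewrite tensor_mul.unlock => t; apply: (@mulr1 A). Qed.
Fact tensor_mulDl : left_distributive mulT +%R.
Proof. by rewrite tensor_mul.unlock => t u v; apply: (@mulrDl A). Qed.
Fact tensor_mulDr : right_distributive mulT +%R.
Proof. by rewrite tensor_mul.unlock => t u v; apply: (@mulrDr A). Qed.
Fact tensor_1_neq0 : (1 : A) != 0.
Proof. exact: oner_neq0. Qed.

HB.instance Definition _ := GRing.Zmodule_isNzRing.Build T
  tensor_mulA tensor_mul1 tensor_mulr1 tensor_mulDl tensor_mulDr tensor_1_neq0.

Fact tensor_scaleAl (a : K) (t u : T) : a *: (mulT t u) = mulT (a *: t) u.
Proof. by rewrite tensor_mul.unlock; apply: (@scalerAl K A). Qed.
Fact tensor_scaleAr (a : K) (t u : T) : a *: (mulT t u) = mulT t (a *: u).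
Proof. by rewrite tensor_mul.unlock; apply: malg_scalerAr. Qed.

HB.instance Definition _ := GRing.Lmodule_isLalgebra.Build K T tensor_scaleAl.
HB.instance Definition _ := GRing.Lalgebra_isAlgebra.Build K T tensor_scaleAr.

Lemma tensor_mulE (t u : T) : t * u = (t : A) * (u : A) :> A.
Proof. by rewrite {1}/GRing.mul /= tensor_mul.unlock. Qed.

End TensorRing.

Section TensorAlgebra.
Variables (K : fieldType) (X : choiceType).
Local Notation tensor := (tensor K X).

Implicit Types (s : seq X) (t u : tensor).

Local Notation word := (@word K X).

Definition homog (n : nat) t : bool :=
  all (fun m : {fmonom X} => size m == n) (msupp t).

Definition hcomp n := linext (fun s => if size s == n then word s else 0).


Lemma homogP n t :
  reflect (forall s, t@_(FMonom s) != 0 -> size s = n) (homog n t).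
Proof.
apply: (iffP allP) => [h s|h m mt]; first by rewrite mcoeff_neq0 => /h/eqP.
by apply/eqP/h; rewrite fmK mcoeff_neq0.
Qed.

Lemma homog_size n t (m : {fmonom X}) : homog n t -> m \in msupp t -> size m = n.
Proof. by move=> /allP h /h/eqP. Qed.

Lemma tensorE t : t = \sum_(m <- msupp t) t@_m *: word m.
Proof.
rewrite {1}[t]malg_sumE; apply: eq_bigr => m _.
by rewrite word.unlock fmK.
Qed.

Lemma word1 : word [::] = 1.
Proof. by rewrite word.unlock -fmoneE. Qed.

Lemma word_cat s1 s2 : word (s1 ++ s2) = word s1 * word s2.
Proof.
rewrite tensor_mulE word.unlock malgM_def fgmulUU mulr1.
by rewrite -(fmmulE (FMonom s1) (FMonom s2)).
Qed.

Lemma coef_word s s' : (word s)@_(FMonom s') = (s == s')%:R.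
Proof. by rewrite word.unlock mcoeffU. Qed.

Section Linext.
Variables (W : lmodType K) (f : seq X -> W).

Lemma linextEw (d : {fset {fmonom X}}) t : (msupp t `<=` d)%fset ->
  linext f t = \sum_(m <- d) t@_m *: f m.
Proof.
move=> le; rewrite linext.unlock [LHS](big_fset_incl _ le) => //= m _ /mcoeff_outdom ->.
by rewrite scale0r.
Qed.

Lemma linext_is_linear : linear (linext f).
Proof.
move=> a t u; set d := (msupp t `|` msupp u)%fset.
have dt : (msupp t `<=` d)%fset by apply: fsubsetUl.
have du : (msupp u `<=` d)%fset by apply: fsubsetUr.
have dtu : (msupp (a *: t + u) `<=` d)%fset.
  apply/fsubsetP => m; rewrite in_fsetU -!mcoeff_neq0 mcoeffD mcoeffZ.
  apply: contraNT; rewrite negb_or !negbK => /andP[/eqP -> /eqP ->].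
  by rewrite mulr0 addr0.
rewrite (linextEw dt) (linextEw du) (linextEw dtu) scaler_sumr -big_split /=.
by apply: eq_bigr => m _; rewrite mcoeffD mcoeffZ scalerDl scalerA.
Qed.

HB.instance Definition _ :=
  GRing.isLinear.Build K tensor W _ (linext f) linext_is_linear.

Lemma linext_word s : linext f (word s) = f s.
Proof.
rewrite word.unlock (linextEw msuppU_le) big_seq_fset1.
by rewrite mcoeffUU scale1r.
Qed.

End Linext.

HB.instance Definition _ n := GRing.Linear.on (hcomp n).

Lemma eq_homog (W : lmodType K) (f g : {linear tensor -> W}) n t :
  (forall s, size s = n -> f (word s) = g (word s)) -> homog n t -> f t = g t.
Proof.
move=> fg ht; rewrite [t]tensorE !linear_sum big_seq [RHS]big_seq.
apply: eq_bigr => m mt; rewrite !linearZ /= fg //.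
exact: homog_size mt.
Qed.

Lemma eq_linear_word (W : lmodType K) (f g : {linear tensor -> W}) :
  (forall s, f (word s) = g (word s)) -> f =1 g.
Proof.
move=> fg t; rewrite [t]tensorE !linear_sum; apply: eq_bigr => m _.
by rewrite !linearZ /= fg.
Qed.

Lemma homog0 n : homog n 0.
Proof. by apply/homogP => s; rewrite mcoeff0 eqxx. Qed.

Lemma homogD n t u : homog n t -> homog n u -> homog n (t + u).
Proof.
move=> /homogP ht /homogP hu; apply/homogP => s; rewrite mcoeffD.
have [-> |/ht //] := eqVneq t@_(FMonom s) 0.
by rewrite add0r => /hu.
Qed.

Lemma homogZ n a t : homog n t -> homog n (a *: t).
Proof.
move=> /homogP ht; apply/homogP => s.
by rewrite mcoeffZ mulf_eq0 negb_or => /andP[_ /ht].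
Qed.

Lemma homog_sum n (I : eqType) (r : seq I) (F : I -> tensor) :
  (forall i, i \in r -> homog n (F i)) -> homog n (\sum_(i <- r) F i).
Proof.
move=> h; rewrite big_seq; elim/big_ind: _ => //; first exact: homog0.
exact: homogD.
Qed.

Lemma homog_word s : homog (size s) (word s).
Proof.
by apply/homogP => s'; rewrite coef_word; case: (s =P s') => [->|]; rewrite ?eqxx.
Qed.

Lemma homogM m n t u : homog m t -> homog n u -> homog (m + n) (t * u).
Proof.
move=> ht hu; rewrite [t]tensorE mulr_suml; apply: homog_sum => k kt.
rewrite [u]tensorE mulr_sumr; apply: homog_sum => l lu.
rewrite -scalerAl -scalerAr; do 2!apply: homogZ; rewrite -word_cat.
rewrite -(homog_size ht kt) -(homog_size hu lu).
by rewrite -size_cat; apply: homog_word.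
Qed.

Lemma homog_linext n f t :
  (forall s, size s = n -> homog n (f s)) -> homog n t -> homog n (linext f t).
Proof.
move=> hf ht; rewrite linext.unlock; apply: homog_sum => m mt.
exact/homogZ/hf/(homog_size ht).
Qed.

Lemma hcomp_word n s : hcomp n (word s) = if size s == n then word s else 0.
Proof. exact: linext_word. Qed.

Lemma hcomp_homog n t : homog n (hcomp n t).
Proof.
rewrite /hcomp linext.unlock; apply: homog_sum => m _.
apply: homogZ; case: eqP => [<-|_].
  exact: homog_word.
exact: homog0.
Qed.

Definition lmulT u t := u * t.
Definition rmulT u t := t * u.

Lemma lmulT_is_linear u : linear (lmulT u).
Proof. by move=> a t t'; rewrite /lmulT mulrDr scalerAr. Qed.

Lemma rmulT_is_linear u : linear (rmulT u).
Proof. by move=> a t t'; rewrite /rmulT mulrDl scalerAl. Qed.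

HB.instance Definition _ u :=
  GRing.isLinear.Build K tensor tensor _ (lmulT u) (lmulT_is_linear u).
HB.instance Definition _ u :=
  GRing.isLinear.Build K tensor tensor _ (rmulT u) (rmulT_is_linear u).

Lemma hcomp_wordM n x t : hcomp n.+1 (word [:: x] * t) = word [:: x] * hcomp n t.
Proof.
move: t; apply: (eq_linear_word (f := hcomp n.+1 \o lmulT (word [:: x]))
  (g := lmulT (word [:: x]) \o hcomp n)) => s /=.
by rewrite /lmulT -word_cat !hcomp_word /= eqSS; case: eqP; rewrite ?mulr0 // -word_cat.
Qed.

Lemma hcomp_Mword n x t : hcomp n.+1 (t * word [:: x]) = hcomp n t * word [:: x].
Proof.
move: t; apply: (eq_linear_word (f := hcomp n.+1 \o rmulT (word [:: x]))
  (g := rmulT (word [:: x]) \o hcomp n)) => s /=.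
rewrite /rmulT -word_cat !hcomp_word /= size_cat addn1 eqSS.
by case: eqP; rewrite ?mul0r // -word_cat.
Qed.

Lemma hcomp0_wordM x t : hcomp 0 (word [:: x] * t) = 0.
Proof.
rewrite [t]tensorE mulr_sumr linear_sum big1 // => m _.
by rewrite -scalerAr linearZ /= -word_cat hcomp_word /= scaler0.
Qed.

Lemma hcomp0_Mword x t : hcomp 0 (t * word [:: x]) = 0.
Proof.
rewrite [t]tensorE mulr_suml linear_sum big1 // => m _.
by rewrite -scalerAl linearZ /= -word_cat hcomp_word size_cat addn1 /= scaler0.
Qed.

End TensorAlgebra.

Arguments homog_word {K X} s.

(** * Braided vector spaces and Nichols algebras *)

Section Braiding.
Variables (K : fieldType) (X : choiceType).
Local Notation T := (tensor K X).

(* Given c x y, the image of the tensor of two basis vectors x and y, this is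
   the map c in positions i and i + 1 (counted from 0).  The value on words too
   short to have these two positions is irrelevant. *)
Definition braid_at (c : X -> X -> T) (i : nat) : T -> T :=
  linext (fun s => if drop i s is x :: y :: s'
                   then word K (take i s) * c x y * word K s' else word K s).

(* A braiding on the vector space V with basis X: braid_map x y is the image of
   the tensor of x and y, and braid_inv says that the resulting endomorphism of
   the tensor square of V is bijective. *)
Record braiding := Braiding {
  braid_map :> X -> X -> T;
  braid_homog : forall x y, homog 2 (braid_map x y);
  braid_inv : exists d : X -> X -> T, (forall x y, homog 2 (d x y)) /\
    forall x y, braid_at d 0 (braid_map x y) = word K [:: x; y] /\
                braid_at braid_map 0 (d x y) = word K [:: x; y];
  braid_eq : forall x y z, let s := word K [:: x; y; z] in
    let b := braid_at braid_map in b 0 (b 1 (b 0 s)) = b 1 (b 0 (b 1 s))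
}.

HB.instance Definition _ c i := GRing.Linear.on (braid_at c i).

Variable c : braiding.
Local Notation sigma := (braid_at c).

Definition braid_perm n (x : 'S_n) : T -> T := word_act sigma (shortest x).

(* The operator Q_n.  The product of permutations composes from left to right;
   with the opposite convention each x is replaced by its inverse, which does
   not change the sum. *)
Definition quantum_sym n (t : T) : T := \sum_(x : 'S_n) braid_perm x t.

Lemma braid_at_homog n i t : homog n t -> homog n (sigma i t).
Proof.
apply: homog_linext => s <-.
case ds: (drop i s) => [|x [|y s']].
- exact: homog_word.
- exact: homog_word.
have -> : size s = (size (take i s) + 2 + size s')%N.
  by rewrite -[in LHS](cat_take_drop i s) ds size_cat /= -addnA add2n.
apply: homogM; last exact: homog_word.
apply: homogM; [exact: homog_word | exact: braid_homog].
Qed.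

Lemma braid_at_word i s : sigma i (word K s) =
  if drop i s is x :: y :: s' then word K (take i s) * c x y * word K s'
  else word K s.
Proof. exact: linext_word. Qed.

Lemma braid_at_mull m i u t : homog m u -> sigma (m + i) (u * t) = u * sigma i t.
Proof.
move=> hu; apply: (eq_homog (f := sigma (m + i) \o rmulT t)
  (g := rmulT (sigma i t)) _ hu) => s <- /=; rewrite /rmulT.
move: t; apply: (eq_linear_word (f := sigma (size s + i) \o lmulT (word K s))
  (g := lmulT (word K s) \o sigma i)) => s' /=; rewrite /lmulT.
rewrite -word_cat !braid_at_word drop_cat ltnNge leq_addr addKn /=.
case: (drop i s') => [|x [|y s'']]; [exact: word_cat | exact: word_cat |].
by rewrite take_cat ltnNge leq_addr addKn /= word_cat !mulrA.
Qed.

Lemma braid_at_mulr m i t u : (i.+1 < m)%N -> homog m t ->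
  sigma i (t * u) = sigma i t * u.
Proof.
move=> im ht; apply: (eq_homog (f := sigma i \o rmulT u)
  (g := rmulT u \o sigma i) _ ht) => s sm /=; rewrite /rmulT.
move: u; apply: (eq_linear_word (f := sigma i \o lmulT (word K s))
  (g := lmulT (sigma i (word K s)))) => s' /=; rewrite /lmulT.
rewrite -word_cat !braid_at_word drop_cat sm (ltnW im).
have := size_drop i s; rewrite sm; case: (drop i s) => [|x [|y s'']] /=; try lia.
move=> _; rewrite take_cat sm (ltnW im) word_cat.
by rewrite [LHS]mulrA.
Qed.

Lemma braid_at_comm m i j t : (i.+1 < j)%N -> (j.+1 < m)%N -> homog m t ->
  sigma i (sigma j t) = sigma j (sigma i t).
Proof.
move=> ij jm ht'; apply: (eq_homog (f := sigma i \o sigma j)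
  (g := sigma j \o sigma i) _ ht') => s sm /=.
have st : size (take j s) = j by rewrite size_takel // sm; lia.
have ht : homog j (word K (take j s)) by rewrite -[X in homog X _]st; exact: homog_word.
have sj u v : homog j u -> sigma j (u * v) = u * sigma 0 v.
  by move=> hu; rewrite -{1}(addn0 j); apply: braid_at_mull.
rewrite -(cat_take_drop j s) word_cat (sj _ _ ht) !(braid_at_mulr _ ij ht).
by rewrite sj //; apply: braid_at_homog.
Qed.

Lemma braid_at_braid m i t : (i.+2 < m)%N -> homog m t ->
  sigma i (sigma i.+1 (sigma i t)) = sigma i.+1 (sigma i (sigma i.+1 t)).
Proof.
move=> im ht'; apply: (eq_homog (f := sigma i \o (sigma i.+1 \o sigma i))
  (g := sigma i.+1 \o (sigma i \o sigma i.+1)) _ ht') => s sm /=.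
have st : size (take i s) = i by rewrite size_takel // sm; lia.
have ht : homog i (word K (take i s)) by rewrite -[X in homog X _]st; exact: homog_word.
have := size_drop i s; rewrite sm -{2 3}[s](cat_take_drop i s).
case: (drop i s) => [|x [|y [|z s']]] /=; try lia; move=> _.
have h3 : homog 3 (word K [:: x; y; z]) by apply: homog_word.
rewrite -[x :: _]/([:: x; y; z] ++ s') !word_cat.
have lt1 : (1 < 3)%N by []; have lt2 : (2 < 3)%N by [].
have s0 u : sigma i (word K (take i s) * u) = word K (take i s) * sigma 0 u.
  by rewrite -{1}(addn0 i) (braid_at_mull _ _ ht).
have s1 u : sigma i.+1 (word K (take i s) * u) = word K (take i s) * sigma 1 u.
  by rewrite -{1}(addn1 i) (braid_at_mull _ _ ht).
have r0 u : homog 3 u -> sigma 0 (u * word K s') = sigma 0 u * word K s'.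
  exact: braid_at_mulr.
have r1 u : homog 3 u -> sigma 1 (u * word K s') = sigma 1 u * word K s'.
  exact: braid_at_mulr.
have H i' u : homog 3 u -> homog 3 (sigma i' u) by apply: braid_at_homog.
rewrite !(s0, s1) (r0 _ h3) (r1 _ h3) (r1 _ (H 0 _ h3)) (r0 _ (H 1 _ h3)).
rewrite (r0 _ (H 1 _ (H 0 _ h3))) (r1 _ (H 0 _ (H 1 _ h3))).
by have /= -> := braid_eq c x y z.
Qed.

(* Any reduced expression of x gives the same operator on the n-th tensor
   power: the operators above do not depend on the choice in [shortest]. *)
Lemma braid_permE n (x : 'S_n) w t : reduced w -> expr w = x -> homog n t ->
  braid_perm x t = word_act sigma w t.
Proof.
move=> rw ew ht; rewrite /braid_perm.
apply: (@matsumoto n T (fun u => homog n u) sigma _ _ _ (shortest x) w t).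
- by move=> i u; apply: braid_at_homog.
- by move=> i j u ij jn; apply: braid_at_comm.
- by move=> i u ij; apply: braid_at_braid.
- exact: reduced_shortest.
- exact: rw.
- by rewrite expr_shortest ew.
- exact: ht.
Qed.

Lemma word_act_linear n (w : seq 'I_n.-1) : linear (word_act sigma w).
Proof. by move=> a t u; elim: w => //= i w ->; rewrite linearP. Qed.

HB.instance Definition _ n (w : seq 'I_n.-1) :=
  GRing.isLinear.Build K T T _ (word_act sigma w) (word_act_linear w).

HB.instance Definition _ n (x : 'S_n) := GRing.Linear.on (braid_perm x).

Lemma quantum_sym_linear n : linear (@quantum_sym n).
Proof.
move=> a t u; rewrite /quantum_sym scaler_sumr -big_split /=.
by apply: eq_bigr => x _; rewrite linearP.
Qed.

HB.instance Definition _ n :=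
  GRing.isLinear.Build K T T _ (@quantum_sym n) (@quantum_sym_linear n).

Lemma word_act_widen n (w : seq 'I_n.-1) t x : homog n t ->
  word_act (n := n.+1) sigma (map (@ord_fst n) w) (t * word K [:: x]) =
  word_act sigma w t * word K [:: x].
Proof.
move=> ht; elim: w => //= i w ->; apply: (braid_at_mulr (m := n)).
  by rewrite ord_succ_subproof.
by apply: (word_actD (D := fun u => homog n u)) => // j u; apply: braid_at_homog.
Qed.

Lemma word_act_shift n (w : seq 'I_n.-1) t x : homog n t ->
  word_act (n := n.+1) sigma (map (@ord_snd n) w) (word K [:: x] * t) =
  word K [:: x] * word_act sigma w t.
Proof.
move=> ht; elim: w => //= i w ->.
by rewrite -[i.+1]/(1 + i)%N (braid_at_mull _ _ (homog_word [:: x])).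
Qed.

Lemma quantum_sym_Mword n t x : homog n t ->
  quantum_sym n t = 0 -> quantum_sym n.+1 (t * word K [:: x]) = 0.
Proof.
move=> ht Qt; rewrite /quantum_sym (sum_lift_perm _ ord_max) big1 // => j _.
pose r := shortest (lift_perm j ord_max 1%g).
suff -> : \sum_z braid_perm (lift_perm j ord_max z) (t * word K [:: x]) =
    word_act sigma r (quantum_sym n t * word K [:: x]).
  by rewrite Qt mul0r linear0.
rewrite mulr_suml linear_sum; apply: eq_bigr => z _ /=.
have [rw ew] := reduced_widen j z.
rewrite (braid_permE rw ew) ?word_act_cat ?word_act_widen //.
by rewrite -addn1; apply: homogM => //; apply: homog_word.
Qed.

Lemma quantum_sym_wordM n t x : homog n t ->
  quantum_sym n t = 0 -> quantum_sym n.+1 (word K [:: x] * t) = 0.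
Proof.
move=> ht Qt; rewrite /quantum_sym (sum_lift_perm _ ord0) big1 // => j _.
pose r := shortest (lift_perm j ord0 1%g).
suff -> : \sum_z braid_perm (lift_perm j ord0 z) (word K [:: x] * t) =
    word_act sigma r (word K [:: x] * quantum_sym n t).
  by rewrite Qt mulr0 linear0.
rewrite mulr_sumr linear_sum; apply: eq_bigr => z _ /=.
have [rw ew] := reduced_shift j z.
rewrite (braid_permE rw ew) ?word_act_cat ?word_act_shift //.
by rewrite -add1n; apply: homogM => //; apply: homog_word.
Qed.

(* The direct sum of the kernels of the Q_n in the tensor powers. *)
Definition nichols_ker : {pred T} :=
  fun t => `[< forall n, quantum_sym n (hcomp n t) = 0 >].

Lemma nichols_kerP t :
  reflect (forall n, quantum_sym n (hcomp n t) = 0) (t \in nichols_ker).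
Proof. exact: asboolP. Qed.

Lemma nichols_ker_zmod_closed : zmod_closed nichols_ker.
Proof.
split=> [|t u]; first by apply/nichols_kerP => n; rewrite !linear0.
move=> /nichols_kerP ht /nichols_kerP hu; apply/nichols_kerP => n.
by rewrite !linearB /= ht hu subr0.
Qed.

HB.instance Definition _ :=
  GRing.isZmodClosed.Build T nichols_ker nichols_ker_zmod_closed.

Lemma nichols_kerZ a t : t \in nichols_ker -> a *: t \in nichols_ker.
Proof.
move=> /nichols_kerP ht; apply/nichols_kerP => n.
by rewrite !linearZ /= ht scaler0.
Qed.

Lemma nichols_kerMr t u : t \in nichols_ker -> t * u \in nichols_ker.
Proof.
move=> ht; rewrite [u]tensorE mulr_sumr; apply: rpred_sum => m _.
rewrite -scalerAr; apply: nichols_kerZ; elim/last_ind: (m : seq X) => [|s x IHs].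
  by rewrite word1 mulr1.
move/nichols_kerP: IHs => IHs; rewrite -cats1 word_cat mulrA.
apply/nichols_kerP => -[|n]; first by rewrite hcomp0_Mword linear0.
by rewrite hcomp_Mword quantum_sym_Mword //; apply: hcomp_homog.
Qed.

Lemma nichols_kerMl t u : t \in nichols_ker -> u * t \in nichols_ker.
Proof.
move=> ht; rewrite [u]tensorE mulr_suml; apply: rpred_sum => m _.
rewrite -scalerAl; apply: nichols_kerZ; elim: (m : seq X) => [|x s IHs].
  by rewrite word1 mul1r.
move/nichols_kerP: IHs => IHs; rewrite -cat1s word_cat -mulrA.
apply/nichols_kerP => -[|n]; first by rewrite hcomp0_wordM linear0.
by rewrite hcomp_wordM quantum_sym_wordM //; apply: hcomp_homog.
Qed.

Lemma nichols_ker1 : 1 \notin nichols_ker.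
Proof.
apply/nichols_kerP => /(_ 0%N); rewrite -word1 hcomp_word /= /quantum_sym.
rewrite (big_pred1 1%g) => [|x]; last first.
  by apply/esym/eqP/permP => -[].
have -> : braid_perm (1 : 'S_0)%g (word K [::]) = word K [::].
  by rewrite /braid_perm; case: (shortest _) => [|[]].
by rewrite word1; apply/eqP/oner_neq0.
Qed.

Definition nichols := {ideal_quot nichols_ker}.

HB.instance Definition _ := Choice.on nichols.
HB.instance Definition _ := GRing.Zmodule.on nichols.

Definition nichols_pi : T -> nichols := \pi_{ideal_quot nichols_ker}.

Lemma nichols_piP t u : nichols_pi t = nichols_pi u <-> t - u \in nichols_ker.
Proof. by rewrite Quotient.idealrBE; split => /eqP. Qed.

Let rep (a : nichols) : T :=
  generic_quotient.repr (a : {ideal_quot nichols_ker}).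

Let repK (a : nichols) : nichols_pi (rep a) = a.
Proof. exact: reprK. Qed.

Let piD t u : nichols_pi (t + u) = nichols_pi t + nichols_pi u.
Proof. by rewrite /nichols_pi !piE. Qed.

Let one_nichols := nichols_pi 1.
Let mul_nichols (a b : nichols) := nichols_pi (rep a * rep b).
Let scale_nichols (k : K) (a : nichols) := nichols_pi (k *: rep a).

Let pi_mul t u : mul_nichols (nichols_pi t) (nichols_pi u) = nichols_pi (t * u).
Proof.
apply/nichols_piP; set t' := rep _; set u' := rep _.
have -> : t' * u' - t * u = (t' - t) * u' + t * (u' - u).
  by rewrite mulrBl mulrBr addrA subrK.
have kt : t' - t \in nichols_ker by apply: (nichols_piP _ _).1; apply: repK.
have ku : u' - u \in nichols_ker by apply: (nichols_piP _ _).1; apply: repK.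
by apply: rpredD; [apply: nichols_kerMr | apply: nichols_kerMl].
Qed.

Let pi_scale k t : scale_nichols k (nichols_pi t) = nichols_pi (k *: t).
Proof.
apply/nichols_piP; rewrite -scalerBr; apply: nichols_kerZ.
by apply: (nichols_piP _ _).1; apply: repK.
Qed.

Let pi_surj (a : nichols) : exists t, a = nichols_pi t.
Proof. by exists (rep a); rewrite repK. Qed.

Fact nichols_mulA : associative mul_nichols.
Proof.
move=> a b d; have [t ->] := pi_surj a; have [u ->] := pi_surj b.
by have [v ->] := pi_surj d; rewrite !pi_mul mulrA.
Qed.

Fact nichols_mul1 : left_id one_nichols mul_nichols.
Proof. by move=> a; have [t ->] := pi_surj a; rewrite pi_mul mul1r. Qed.

Fact nichols_mulr1 : right_id one_nichols mul_nichols.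
Proof. by move=> a; have [t ->] := pi_surj a; rewrite pi_mul mulr1. Qed.

Fact nichols_mulDl : left_distributive mul_nichols +%R.
Proof.
move=> a b d; have [t ->] := pi_surj a; have [u ->] := pi_surj b.
by have [v ->] := pi_surj d; rewrite -piD !pi_mul -piD mulrDl.
Qed.

Fact nichols_mulDr : right_distributive mul_nichols +%R.
Proof.
move=> a b d; have [t ->] := pi_surj a; have [u ->] := pi_surj b.
by have [v ->] := pi_surj d; rewrite -piD !pi_mul -piD mulrDr.
Qed.

Fact nichols_one_neq0 : one_nichols != 0.
Proof.
apply/negP => /eqP h; have := nichols_ker1; rewrite -[1]subr0 => /negP; apply.
by apply/nichols_piP; rewrite -/one_nichols h /nichols_pi !piE.
Qed.

HB.instance Definition _ := GRing.Zmodule_isNzRing.Build nichols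
  nichols_mulA nichols_mul1 nichols_mulr1 nichols_mulDl nichols_mulDr
  nichols_one_neq0.

Fact nichols_scaleA (k l : K) (a : nichols) :
  scale_nichols k (scale_nichols l a) = scale_nichols (k * l) a.
Proof. by have [t ->] := pi_surj a; rewrite !pi_scale scalerA. Qed.

Fact nichols_scale1 : left_id 1 scale_nichols.
Proof. by move=> a; have [t ->] := pi_surj a; rewrite pi_scale scale1r. Qed.

Fact nichols_scaleDr : right_distributive scale_nichols +%R.
Proof.
move=> k a b; have [t ->] := pi_surj a; have [u ->] := pi_surj b.
by rewrite -piD !pi_scale -piD scalerDr.
Qed.

Fact nichols_scaleDl (a : nichols) : {morph scale_nichols^~ a : k l / k + l}.
Proof.
by move=> k l; have [t ->] := pi_surj a; rewrite !pi_scale -piD scalerDl.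
Qed.

HB.instance Definition _ := GRing.Zmodule_isLmodule.Build K nichols
  nichols_scaleA nichols_scale1 nichols_scaleDr nichols_scaleDl.

Fact nichols_scaleAl (k : K) (a b : nichols) : k *: (a * b) = (k *: a) * b.
Proof.
have [t ->] := pi_surj a; have [u ->] := pi_surj b.
by rewrite [LHS](congr1 (scale_nichols k) (pi_mul t u)) pi_scale
  [X in _ = X * _]pi_scale [RHS]pi_mul scalerAl.
Qed.

HB.instance Definition _ :=
  GRing.Lmodule_isLalgebra.Build K nichols nichols_scaleAl.

Fact nichols_scaleAr (k : K) (a b : nichols) : k *: (a * b) = a * (k *: b).
Proof.
have [t ->] := pi_surj a; have [u ->] := pi_surj b.
by rewrite [LHS](congr1 (scale_nichols k) (pi_mul t u)) pi_scale
  [X in _ = _ * X]pi_scale [RHS]pi_mul scalerAr.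
Qed.

HB.instance Definition _ :=
  GRing.Lalgebra_isAlgebra.Build K nichols nichols_scaleAr.

Fact nichols_pi_linear : linear nichols_pi.
Proof. by move=> k t u; rewrite piD -pi_scale. Qed.

HB.instance Definition _ :=
  GRing.isLinear.Build K T nichols _ nichols_pi nichols_pi_linear.

Fact nichols_pi_monoid_morphism : monoid_morphism nichols_pi.
Proof. by split=> // t u; rewrite -pi_mul. Qed.

HB.instance Definition _ :=
  GRing.isMonoidMorphism.Build T nichols nichols_pi nichols_pi_monoid_morphism.

Definition nichols_gen (x : X) : nichols := nichols_pi (word K [:: x]).

(* The homogeneous component of degree n, i.e. the n-th tensor power modulo
   the kernel of Q_n. *)
Definition nichols_comp n (a : nichols) : Prop :=
  exists2 t, homog n t & a = nichols_pi t.

Lemma nichols_comp_ker n t : homog n t ->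
  nichols_pi t = 0 <-> quantum_sym n t = 0.
Proof.
move=> ht; have hc m : hcomp m t = if m == n then t else 0.
  have -> : (if m == n then t else 0) = ((m == n)%:R : K) *: t.
    by case: eqP; rewrite ?scale1r ?scale0r.
  apply: (eq_homog (g := ((m == n)%:R : K) \*: idfun) _ ht) => s sn /=.
  by rewrite hcomp_word sn eq_sym; case: eqP; rewrite ?scale1r ?scale0r.
rewrite -(linear0 nichols_pi); split.
  by move/nichols_piP; rewrite subr0 => /nichols_kerP/(_ n); rewrite hc eqxx.
move=> Qt; apply/nichols_piP; rewrite subr0; apply/nichols_kerP => m.
by rewrite hc; case: eqP => [->|] //; rewrite linear0.
Qed.

End Braiding.

(** * Presentations, bases and dimensions *)

Section Algebras.
Variables (K : fieldType) (X : choiceType).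

(* The algebra morphism from the free algebra on X that maps x to g x. *)
Definition free_eval (A : algType K) (g : X -> A) : tensor K X -> A :=
  linext (fun s => \prod_(x <- s) g x).

(* The two-sided ideal generated by rels. *)
Definition ideal_gen (rels : seq (tensor K X)) (t : tensor K X) : Prop :=
  exists s : seq (tensor K X * tensor K X * tensor K X),
    (forall p, p \in s -> p.1.2 \in rels) /\
    t = \sum_(p <- s) p.1.1 * p.1.2 * p.2.

(* A is presented by the generators g x and the relations rels. *)
Definition presented (A : algType K) (g : X -> A) (rels : seq (tensor K X)) :=
  (forall a, exists t, free_eval g t = a) /\
  (forall t, free_eval g t = 0 <-> ideal_gen rels t).

(* s, counted with multiplicities, is a basis of the subspace S. *)
Definition lbasis (V : lmodType K) (S : V -> Prop) (s : seq V) : Prop :=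
  [/\ forall v, v \in s -> S v,
      forall v, S v -> exists a : 'I_(size s) -> K, v = \sum_i a i *: s`_i
    & forall a : 'I_(size s) -> K,
        \sum_i a i *: s`_i = 0 -> forall i, a i = 0].

Definition has_dim (V : lmodType K) (S : V -> Prop) (n : nat) : Prop :=
  exists2 s, lbasis S s & size s = n.

Variable c : braiding K X.

Definition hilbert_poly (P : {poly int}) : Prop :=
  forall n, exists2 d : nat, has_dim (@nichols_comp _ _ c n) d & P`_n = d%:Z.

Definition top_degree (n : nat) : Prop :=
  (exists2 a : nichols c, nichols_comp n a & a <> 0) /\
  (forall m (a : nichols c), (n < m)%N -> nichols_comp m a -> a = 0).

Definition integral (a : nichols c) : Prop :=
  exists n, [/\ top_degree n, nichols_comp n a & a <> 0].

Definition gen_prod (s : seq X) : nichols c := \prod_(x <- s) nichols_gen c x.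

(* All the products of one element of each row, from the first row on. *)
Definition row_products (rows : seq (seq (seq X))) : seq (nichols c) :=
  foldr (fun row acc => [seq gen_prod s * a | s <- row, a <- acc]) [:: 1] rows.

End Algebras.

(** * The affine crossed set on Z/5 *)

Section Affine.
Variable K : fieldType.

Definition affine5_op (i j : 'Z_5) : 'Z_5 := 2 * j - i.

Definition affine5_map (i j : 'Z_5) : tensor K 'Z_5 :=
  - word K [:: affine5_op i j; i].

Lemma affine5_homog i j : homog 2 (affine5_map i j).
Proof. by rewrite /affine5_map -scaleN1r; apply/homogZ/homog_word. Qed.

Lemma affine5_inv : exists d : 'Z_5 -> 'Z_5 -> tensor K 'Z_5,
  (forall x y, homog 2 (d x y)) /\
  forall x y, braid_at d 0 (affine5_map x y) = word K [:: x; y] /\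
              braid_at affine5_map 0 (d x y) = word K [:: x; y].
Proof.
exists (fun a b => - word K [:: b; 3 * (a + b)]); split=> [x y|x y].
  by rewrite -scaleN1r; apply/homogZ/homog_word.
rewrite /affine5_map; split; rewrite /braid_at linearN /= linext_word /=.
  rewrite word1 mul1r mulr1 opprK; congr (word K [:: _; _]).
  rewrite /affine5_op; move: x y; do 2!case=> [[|[|[|[|[|//]]]]] ?]; exact: val_inj.
rewrite word1 mul1r mulr1 opprK; congr (word K [:: _; _]).
rewrite /affine5_op; move: x y; do 2!case=> [[|[|[|[|[|//]]]]] ?]; exact: val_inj.
Qed.

Lemma affine5_braid x y z : let s := word K [:: x; y; z] in
  let b := braid_at affine5_map in b 0 (b 1 (b 0 s)) = b 1 (b 0 (b 1 s)).
Proof.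
move=> s b.
have b0 x' y' z' : b 0 (word K [:: x'; y'; z']) =
    - word K [:: affine5_op x' y'; x'; z'].
  by rewrite /b /braid_at linext_word /= word1 mul1r mulNr -word_cat.
have b1 x' y' z' : b 1 (word K [:: x'; y'; z']) =
    - word K [:: x'; affine5_op y' z'; y'].
  by rewrite /b /braid_at linext_word /= word1 mulr1 mulrN -word_cat.
have bN i t : b i (- t) = - b i t by rewrite /b linearN.
have op3 : affine5_op (affine5_op x y) (affine5_op x z) =
    affine5_op x (affine5_op y z).
  have h (R : comNzRingType) (i j k : R) :
      2 * (2 * k - i) - (2 * j - i) = 2 * (2 * k - j) - i by ring.
  exact: h.
move: b b0 b1 bN => b b0 b1 bN; rewrite /s.
by rewrite b0 bN b1 bN bN b0 b1 bN b0 bN bN b1 op3.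
Qed.

Definition affine5 : braiding K 'Z_5 :=
  Braiding affine5_homog affine5_inv affine5_braid.

Local Notation w := (word K).

Definition affine5_rels : seq (tensor K 'Z_5) :=
  [:: w [:: 0; 0]; w [:: 1; 1]; w [:: 2; 2]; w [:: 3; 3]; w [:: 4; 4];
      w [:: 3; 2] + w [:: 2; 0] + w [:: 1; 3] + w [:: 0; 1];
      w [:: 4; 0] + w [:: 2; 1] + w [:: 1; 4] + w [:: 0; 2];
      w [:: 4; 1] + w [:: 3; 4] + w [:: 1; 0] + w [:: 0; 3];
      w [:: 4; 2] + w [:: 3; 0] + w [:: 2; 3] + w [:: 0; 4];
      w [:: 4; 3] + w [:: 3; 1] + w [:: 2; 4] + w [:: 1; 2];
      w [:: 1; 0; 1; 0] + w [:: 0; 1; 0; 1]].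

End Affine.

Definition affine5_rows : seq (seq (seq 'Z_5)) :=
  [:: [:: [::]; [:: 0]];
      [:: [::]; [:: 1]; [:: 1; 0]; [:: 1; 0; 1]];
      [:: [::]; [:: 2]; [:: 2; 1]; [:: 2; 1; 2]; [:: 2; 0]; [:: 2; 0; 1];
          [:: 2; 0; 1; 2]; [:: 2; 0; 1; 0]; [:: 2; 0; 1; 0; 2];
          [:: 2; 0; 1; 0; 2; 0]];
      [:: [::]; [:: 3]; [:: 3; 1]; [:: 3; 1; 2]; [:: 3; 0]; [:: 3; 0; 3];
          [:: 3; 0; 3; 1]; [:: 3; 0; 3; 1; 2]];
      [:: [::]; [:: 4]]].

Definition affine5_hilbert : {poly int} :=
  (1 + 'X) ^+ 2 * (1 + 'X + 'X^2 + 'X^3) *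
  (1 + 'X + 2 * 'X^2 + 2 * 'X^3 + 2 * 'X^4 + 'X^5 + 'X^6) *
  (1 + 'X + 2 * 'X^2 + 2 * 'X^3 + 'X^4 + 'X^5).

Definition affine5_hilbert_expanded : {poly int} :=
  'X^16 + 5 * 'X^15 + 15 * 'X^14 + 35 * 'X^13 + 66 * 'X^12 + 105 * 'X^11 +
  145 * 'X^10 + 175 * 'X^9 + 186 * 'X^8 + 175 * 'X^7 + 145 * 'X^6 +
  105 * 'X^5 + 66 * 'X^4 + 35 * 'X^3 + 15 * 'X^2 + 5 * 'X + 1.

(* Main.v *)
From HB Require Import structures.
Require Import Defs.
From mathcomp Require Import all_boot all_order all_fingroup all_algebra.
From mathcomp Require Import zify ring.
From mathcomp Require Import monalg reals complex.

Set Implicit Arguments.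
Unset Strict Implicit.
Unset Printing Implicit Defensive.

Import GRing.Theory.

Local Open Scope ring_scope.

(** Let I be the ideal generated by the relations, inside the free algebra T,
    and let J be the sum of the kernels of the operators Q_n, so that the
    Nichols algebra is T / J. Everything follows from three facts, which hold
    over any field: I is contained in J; the 1280 row words (one factor from
    each row) span T modulo I; and they are linearly independent modulo J.
    Indeed an element of J is then congruent modulo I to a combination of row
    words lying in J, which is zero, so I = J, and the row words are a basis.
    The basis is made of words, so the homogeneous components are read off by
    counting letters, and the Hilbert polynomial is a product over the rows.

    The tool for J is a family of skew derivations. Each permutation of n + 1
    positions factors, with lengths adding up, into a permutation of the first
    n positions and a cycle that moves one letter to the last position
    ([reduced_widen_descent]). Hence Q_(n+1) t is the sum over the letters x of
    Q_n (d_x t) x, where d_x collects the ways to move a letter x to the end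
    and then deletes it ([quantum_sym_sderiv]). So t lies in J as soon as it
    has no constant term and all the d_x t lie in J, and conversely d_x maps J
    to itself.

    Inclusion of I in J ([ideal_sub_ker]): d_x satisfies a Leibniz rule twisted
    by the action of x on words, and the relations have all their derivatives
    and twists in I; hence d_x maps I to itself, and induction on the degree
    concludes.

    Spanning ([spanned_all]): for the degree-lexicographic order with
    4 > 3 > 2 > 1 > 0 the relations can be completed into 28 rewriting rules
    with coefficients 1 and -1, a Groebner basis whose normal words are exactly
    the row words. What is needed from these rules is that they hold modulo I
    and that a word r of row k followed by a letter x <= k can be rewritten
    into words of the form v r', with r' in row k and v a word in the letters
    smaller than k. Induction on k then shows that the span of the words of
    rows 0 to k is stable by right multiplication by the letters 0, ..., k.

    Independence ([normal_words_free]): each word r of row k has a dual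
    sequence D_r of derivations, of the same length, such that for all words u
    in the letters smaller than k, D_r (u r) is u up to sign, while D_r (u r')
    is 0 if r' comes after r in the row, ordered by decreasing length. Applied
    in this order, they extract from an element of J written as a sum of t_r r
    the coefficients t_r, which therefore lie in J; so independence for rows 0
    to k reduces to independence for rows 0 to k - 1. *)

(** * Factoring out the value at the last position *)

Section LastCoset.
Variable n : nat.
Implicit Types (j : 'I_n.+1) (z : 'S_n) (r : seq 'I_n.+1.-1).

Let widen (w : seq 'I_n.-1) : seq 'I_n.+1.-1 := map (@ord_fst n) w.

Lemma rev_iotaS (j m : nat) : rev (iota j m.+1) = (j + m)%N :: rev (iota j m).
Proof. by rewrite -{1}addn1 iotaD rev_cat. Qed.

Lemma expr_descent r (j m : nat) : map val r = rev (iota j m) ->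
  forall k : 'I_n.+1, expr r k =
    (if k == (j + m)%N :> nat then j else
     if (j <= k < j + m)%N then k.+1 else k) :> nat.
Proof.
elim: m r => [|m IHm] r.
  case: r => // _ k; rewrite /expr big_nil perm1 addn0.
  by do 2?case: ifP => //; lia.
case: r => [|i r]; rewrite [rev _](rev_iotaS j m) // => -[ij /IHm{}IHm] k.
have ij' : i = (j + m)%N :> nat by [].
rewrite expr_cons permM IHm tau_val ij'.
by case: (k =P (j + m)%N :> nat); case: (k =P (j + m).+1 :> nat);
  do 4?case: ifP; lia.
Qed.

Lemma reduced_descent r (j m : nat) :
  map val r = rev (iota j m) -> reduced r.
Proof.
elim: m r => [|m IHm] [|i r] //=.
- by move=> _; rewrite /reduced /expr big_nil inversions1.
- by rewrite [rev _](rev_iotaS j m).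
rewrite [rev _](rev_iotaS j m) => -[ij h].
have ij' : i = (j + m)%N :> nat by [].
apply: reduced_desc; last exact: IHm h.
by rewrite !(expr_descent h) /= ij'; do 4?case: ifP => //; lia.
Qed.

(** The words n-1, ..., j thus represent the shortest elements of the cosets of
    the permutations that fix the last position. *)
Lemma expr_descent_lift r j : map val r = rev (iota j (n - j)) ->
  expr r = lift_perm ord_max j 1.
Proof.
move=> h; apply/permP => k; apply: val_inj; rewrite /= (expr_descent h).
have := ltn_ord j; rewrite ltnS => jn; rewrite subnKC //.
case: (unliftP ord_max k) => [l|] ->.
  rewrite lift_perm_lift perm1 lift_max (ltn_eqF (ltn_ord l)) ltn_ord andbT.
  by rewrite /= /bump; case: leqP.
by rewrite lift_perm_id /= eqxx.
Qed.

(** A permutation of the first n positions preserves the number of inversions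
    that involve the last one: it only permutes the values preceding it. *)
Lemma inversions_lift_from_max j z : inversions (lift_perm ord_max j z) =
  (inversions (lift_perm ord_max j 1%g) + inversions z)%N.
Proof.
suff [C h] : exists C, forall z, inversions (lift_perm ord_max j z) =
    (C + inversions z)%N by rewrite !h inversions1 addn0.
exists (\sum_(k < n) (j < lift j k)%N)%N => {}z.
rewrite /inversions (bigD1_ord ord_max) // big1 ?add0n => [|k _]; last first.
  by rewrite ltnNge -ltnS ltn_ord.
rewrite [X in (X + _)%N](reindex_inj (@perm_inj _ z)) -big_split.
apply: eq_bigr => k _; rewrite (bigD1_ord ord_max) //.
rewrite lift_perm_id lift_perm_lift lift_max ltn_ord.
congr (_ + _)%N; apply: eq_bigr => l _.
by rewrite !lift_max lift_perm_lift ltn_lift.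
Qed.

(** Here the lengths of the two factors add up, so that the operator attached
    to a permutation is the composite of those attached to its factors. *)
Lemma reduced_widen_descent r j z : map val r = rev (iota j (n - j)) ->
  reduced (widen (shortest z) ++ r) /\
  expr (widen (shortest z) ++ r) = lift_perm ord_max j z.
Proof.
move=> h; have e : expr (widen (shortest z) ++ r) = lift_perm ord_max j z.
  rewrite expr_cat expr_widen expr_shortest (expr_descent_lift h).
  by rewrite lift_permM mulg1.
split=> //; rewrite /reduced e inversions_lift_from_max -(expr_descent_lift h).
by rewrite -(eqP (reduced_descent h)) size_cat size_map size_shortest addnC.
Qed.

Lemma descent_exists j :
  exists r : seq 'I_n.+1.-1, map val r = rev (iota j (n - j)).
Proof.
exists [seq i : 'I_n <- rev (enum 'I_n) | (j <= i)%N].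
transitivity [seq i <- map (@nat_of_ord n) (rev (enum 'I_n)) | (j <= i)%N].
  by rewrite filter_map.
rewrite map_rev (val_enum_ord n) filter_rev; congr rev.
have jn : (j <= n)%N by rewrite -ltnS ltn_ord.
move: (nat_of_ord j) jn => {}j jn.
rewrite -{1}(subnKC jn) iotaD filter_cat add0n.
rewrite (_ : filter _ (iota 0 j) = [::]); last first.
  by apply/eqP; rewrite -[_ == _]negbK -has_filter -all_predC; apply/allP => i;
    rewrite mem_iota /= -ltnNge.
by apply/all_filterP/allP => i; rewrite mem_iota => /andP[].
Qed.

Lemma sum_lift_perm_from (V : nmodType) (F : 'S_n.+1 -> V) (k : 'I_n.+1) :
  \sum_x F x = \sum_j \sum_(z : 'S_n) F (lift_perm k j z).
Proof.
rewrite (reindex_inj invg_inj) (sum_lift_perm _ k) /=; apply: eq_bigr => j _.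
rewrite (reindex_inj invg_inj) /=; apply: eq_bigr => z _.
by rewrite lift_permV invgK.
Qed.

End LastCoset.

(** * Skew derivations *)

Section SkewDerivations.
Variables (X : finType) (op : X -> X -> X).
Implicit Types (x y : X) (s w : seq X).

(** Integral combinations of words, as lists of terms: unlike elements of the
    tensor algebra they compute, and one list has a value over each field. *)
Definition wpoly := seq (int * seq X).
Implicit Types p q : wpoly.

Definition consp y p : wpoly := [seq (m.1, y :: m.2) | m <- p].
Definition scalep (k : int) p : wpoly := [seq (k * m.1, m.2) | m <- p].

(** Moving the letter x of a word a x b to the right end across b acts on the
    letters of b by x and contributes a sign for each of them; the letter x
    that has reached the end is then dropped. *)
Fixpoint word_sderiv x s : wpoly :=
  if s is y :: s' then
    (if x == y then [:: ((-1) ^+ size s', map (op x) s')] else [::]) ++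
    consp y (word_sderiv x s')
  else [::].

Lemma size_word_sderiv x s m : m \in word_sderiv x s -> (size m.2).+1 = size s.
Proof.
elim: s m => //= y s IHs m; rewrite mem_cat => /orP[|/mapP[m' /IHs <- ->] //].
by case: ifP => // _; rewrite inE => /eqP -> /=; rewrite size_map.
Qed.

Variable K : fieldType.
Local Notation T := (tensor K X).
Local Notation word := (@word K X).

Definition eval p : T := \sum_(m <- p) m.1%:~R *: word m.2.

Lemma eval_cat p q : eval (p ++ q) = eval p + eval q.
Proof. exact: big_cat. Qed.

Lemma eval_cons m p : eval (m :: p) = m.1%:~R *: word m.2 + eval p.
Proof. exact: big_cons. Qed.

Lemma eval_nil : eval [::] = 0.
Proof. exact: big_nil. Qed.

Lemma eval1 s : eval [:: (1, s)] = word s.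
Proof. by rewrite eval_cons eval_nil addr0 scale1r. Qed.

Lemma eval_scalep k p : eval (scalep k p) = k%:~R *: eval p.
Proof.
rewrite /eval big_map scaler_sumr; apply: eq_bigr => m _.
by rewrite /= intrM scalerA.
Qed.

Lemma eval_consp y p : eval (consp y p) = word [:: y] * eval p.
Proof.
rewrite /eval big_map mulr_sumr; apply: eq_bigr => m _.
by rewrite -scalerAr -word_cat.
Qed.

Definition sderiv x : T -> T := linext (fun s => eval (word_sderiv x s)).
HB.instance Definition _ x := GRing.Linear.on (sderiv x).

(** The diagonal action of x, with the sign of its passage across a word. *)
Definition twist x : T -> T :=
  linext (fun s => (-1) ^+ size s *: word (map (op x) s)).
HB.instance Definition _ x := GRing.Linear.on (twist x).

Lemma sderiv_word x s : sderiv x (word s) = eval (word_sderiv x s).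
Proof. exact: linext_word. Qed.

Lemma twist_word x s :
  twist x (word s) = (-1) ^+ size s *: word (map (op x) s).
Proof. exact: linext_word. Qed.

Lemma sderiv_word_cat x u w : sderiv x (word (u ++ w)) =
  word u * sderiv x (word w) + sderiv x (word u) * twist x (word w).
Proof.
rewrite twist_word !sderiv_word.
elim: u => [|y u IHu]; first by rewrite word1 mul1r eval_nil mul0r addr0.
rewrite /= !eval_cat !eval_consp IHu mulrDr mulrDl !mulrA -word_cat addrCA.
congr (_ + (_ + _)); case: eqP => _; last by rewrite eval_nil mul0r.
rewrite !eval_cons !eval_nil !addr0 /= !rmorphXn /= rmorphN1 size_cat map_cat.
by rewrite exprD -scalerA word_cat -!(scalerAl, scalerAr).
Qed.

(** The letter moved to the end comes either from u, or from t, and then it has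
    to cross the whole of u. *)
Lemma sderivM x t u :
  sderiv x (t * u) = t * sderiv x u + sderiv x t * twist x u.
Proof.
rewrite [t]tensorE !mulr_suml !linear_sum mulr_suml -big_split.
apply: eq_bigr => m _ /=; rewrite -!scalerAl !linearZ /= -scalerAl -scalerDr.
congr (_ *: _); rewrite [u]tensorE !mulr_sumr !linear_sum !mulr_sumr -big_split.
apply: eq_bigr => l _ /=; rewrite -!scalerAr !linearZ /= -!scalerAr -scalerDr.
by rewrite -word_cat sderiv_word_cat.
Qed.

(** The recursive definition of derivatives against the enumeration of the
    positions from which a letter is moved to the end. *)
Lemma sum_sderiv_word (V : lmodType K) (G : X -> seq X -> V) x0 s :
  \sum_x \sum_(m <- word_sderiv x s) m.1%:~R *: G x m.2 =
  \sum_(j < size s) (-1) ^+ (size s - j.+1) *: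
    G (nth x0 s j) (take j s ++ map (op (nth x0 s j)) (drop j.+1 s)).
Proof.
elim: s G => [|y s IHs] G.
  by rewrite big_ord0 big1 // => x; rewrite big_nil.
rewrite [RHS]big_ord_recl /= drop0 subSS subn0.
rewrite -(IHs (fun x s' => G x (y :: s'))).
under eq_bigr do rewrite big_cat big_map.
rewrite big_split; congr (_ + _).
rewrite (bigD1 y) //= eqxx big_cons big_nil addr0 rmorphXn rmorphN1.
rewrite big1 ?addr0 // => x /negbTE ->.
by rewrite big_nil.
Qed.

Variable c : braiding K X.
Hypothesis cE : forall x y, c x y = - word [:: op x y; x].
Local Notation sigma := (braid_at c).

Lemma word_act_nat n (r : seq 'I_n.-1) t :
  word_act sigma r t = foldr sigma t (map val r).
Proof. by elim: r => //= i r ->. Qed.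

Lemma braid_pull x a b :
  foldr sigma (word (a ++ x :: b)) (rev (iota (size a) (size b))) =
  (-1) ^+ size b *: word (a ++ map (op x) b ++ [:: x]).
Proof.
elim: b a => [|y b IHb] a; first by rewrite scale1r.
rewrite [size (y :: b)]/= [iota _ _]/= rev_cons foldr_rcons braid_at_word.
rewrite drop_size_cat // take_size_cat // cE mulrN mulNr.
have -> (t : T) r : foldr sigma (- t) r = - foldr sigma t r.
  by elim: r => //= i r ->; rewrite linearN.
rewrite -!word_cat -[(a ++ _) ++ b]catA /= -cat_rcons.
rewrite -(size_rcons a (op x y)) IHb cat_rcons exprS -scalerA scaleN1r.
by [].
Qed.

Let term n x : {linear T -> T} :=
  rmulT (word [:: x]) \o (quantum_sym c n \o (hcomp n \o sderiv x)).

(** The operator Q_(n+1) first moves any letter to the last position, in the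
    cheapest way, and then symmetrizes the n other positions. *)
Lemma quantum_sym_sderiv n t : quantum_sym c n.+1 (hcomp n.+1 t) =
  \sum_x quantum_sym c n (hcomp n (sderiv x t)) * word [:: x].
Proof.
transitivity (\sum_x term n x t); last by [].
rewrite [t]tensorE !linear_sum.
rewrite (eq_bigr _ (fun x _ => linear_sum (term n x) _ _ _)) [RHS]exchange_big.
apply: eq_bigr => m _ /=; rewrite !linearZ.
rewrite (eq_bigr _ (fun x _ => linearZ_LR (term n x) _ _)) -scaler_sumr /=.
congr (_ *: _); move: (m : seq X) => {m} s; rewrite hcomp_word.
rewrite /rmulT; transitivity (\sum_x \sum_(m <- word_sderiv x s) m.1%:~R *:
    (quantum_sym c n (hcomp n (word m.2)) * word [:: x])); last first.
  apply: eq_bigr => x _; rewrite sderiv_word /eval !linear_sum mulr_suml.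
  by apply: eq_bigr => m _; rewrite !linearZ /= -scalerAl.
case: eqP => [sn|/eqP sn]; last first.
  rewrite linear0 big1 // => x _.
  rewrite big_seq big1 // => m /size_word_sderiv ms.
  rewrite hcomp_word; case: eqP => [mn|]; first by rewrite -ms mn eqxx in sn.
  by rewrite linear0 mul0r scaler0.
have [x0 _] : exists x0 : X, True by case: s sn => // x; exists x.
rewrite (sum_sderiv_word (fun x s' => quantum_sym c n (hcomp n (word s')) *
  word [:: x]) x0) sn.
rewrite /quantum_sym (sum_lift_perm_from _ ord_max); apply: eq_bigr => j _.
have jn : (j <= n)%N by rewrite -ltnS ltn_ord.
have [r rj] := descent_exists j.
set a := take j s; set b := drop j.+1 s; set x := nth x0 s j.
have sE : s = a ++ x :: b by rewrite /x -drop_nth ?sn // cat_take_drop.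
have sa : size a = j by rewrite size_takel // sn ltnW.
have sb : size b = (n - j)%N by rewrite size_drop sn subSS.
have sab : size (a ++ map (op x) b) = n.
  by rewrite size_cat size_map sa sb subnKC.
rewrite hcomp_word sab eqxx subSS -sb -/(quantum_sym c n _).
under eq_bigr => z _.
  have [rw ew] := reduced_widen_descent z rj.
  rewrite (braid_permE c rw ew); last by rewrite -sn; apply: homog_word.
  rewrite word_act_cat (word_act_nat r) rj -sb {1}sE -{1}sa braid_pull.
  rewrite linearZ /= catA word_cat word_act_widen; last first.
    by rewrite -{1}sab; apply: homog_word.
  over.
by rewrite -scaler_sumr -mulr_suml.
Qed.

End SkewDerivations.

(** * Ideals stable by derivations *)

Section HomogeneousComponents.
Variables (K : fieldType) (X : choiceType).
Local Notation T := (tensor K X).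
Local Notation word := (@word K X).

Lemma hcomp_hcomp m n (t : T) :
  hcomp m (hcomp n t) = if m == n then hcomp n t else 0.
Proof.
have -> : (if m == n then hcomp n t else 0) = (m == n)%:R *: hcomp n t.
  by case: eqP; rewrite ?scale1r ?scale0r.
move: t; apply: (eq_linear_word (f := hcomp m \o @hcomp K X n)
  (g := (m == n)%:R \*: @hcomp K X n)) => s /=.
rewrite hcomp_word; case: eqP => [<-|_]; last by rewrite linear0 scaler0.
by rewrite hcomp_word eq_sym; case: eqP; rewrite ?scale1r ?scale0r.
Qed.

Lemma hcomp_id n (t : T) : homog n t -> hcomp n t = t.
Proof.
apply: (eq_homog (f := @hcomp K X n) (g := idfun)) => s <-.
by rewrite /= hcomp_word eqxx.
Qed.

(** The constant term is a character of the free algebra. *)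
Lemma hcomp0M (t u : T) : hcomp 0 (t * u) = hcomp 0 t * hcomp 0 u.
Proof.
rewrite [t]tensorE mulr_suml !linear_sum mulr_suml; apply: eq_bigr => m _ /=.
rewrite -scalerAl !linearZ /= -scalerAl; congr (_ *: _).
move: u; apply: (eq_linear_word (f := @hcomp K X 0 \o lmulT (word m))
  (g := lmulT (hcomp 0 (word m)) \o @hcomp K X 0)) => s /=.
rewrite /lmulT -word_cat !hcomp_word size_cat addn_eq0.
case: (m : seq X) => [|? ?] /=; last by rewrite mul0r.
by rewrite word1 mul1r.
Qed.

Lemma hcomp_ker (c : braiding K X) n t :
  t \in nichols_ker c -> hcomp n t \in nichols_ker c.
Proof.
move=> /nichols_kerP ht; apply/nichols_kerP => m; rewrite hcomp_hcomp.
by case: eqP => [->|_]; rewrite ?linear0.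
Qed.

End HomogeneousComponents.

Section GeneratedIdeal.
Variables (K : fieldType) (X : choiceType) (rels : seq (tensor K X)).
Local Notation T := (tensor K X).
Local Notation I := (ideal_gen rels).

Lemma ideal_gen_rel g : g \in rels -> I g.
Proof.
move=> gr; exists [:: (1, g, 1)]; split=> [p|]; first by rewrite inE => /eqP ->.
by rewrite big_seq1 /= mul1r mulr1.
Qed.

Lemma ideal_gen0 : I 0.
Proof. by exists [::]; split; rewrite ?big_nil. Qed.

Lemma ideal_genD t u : I t -> I u -> I (t + u).
Proof.
move=> [s [hs ->]] [s' [hs' ->]]; exists (s ++ s'); rewrite big_cat; split=> // p.
by rewrite mem_cat => /orP[/hs|/hs'].
Qed.

Lemma ideal_genMl u t : I t -> I (u * t).
Proof.
move=> [s [hs ->]]; exists [seq (u * p.1.1, p.1.2, p.2) | p <- s]; split.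
  by move=> _ /mapP[p /hs ps ->].
by rewrite big_map mulr_sumr; apply: eq_bigr => p _; rewrite !mulrA.
Qed.

Lemma ideal_genMr u t : I t -> I (t * u).
Proof.
move=> [s [hs ->]]; exists [seq (p.1, p.2 * u) | p <- s]; split.
  by move=> _ /mapP[p /hs ps ->].
by rewrite big_map mulr_suml; apply: eq_bigr => p _; rewrite !mulrA.
Qed.

Lemma ideal_genZ a t : I t -> I (a *: t).
Proof. by move=> It; rewrite -[t]mul1r scalerAl; apply: ideal_genMl. Qed.

Lemma ideal_genN t : I t -> I (- t).
Proof. by rewrite -scaleN1r; apply: ideal_genZ. Qed.

Lemma ideal_gen_trans u t v : I (t - u) -> I (u - v) -> I (t - v).
Proof. by move=> h /(ideal_genD h); rewrite addrA subrK. Qed.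

Lemma ideal_gen_elim (P : T -> Prop) : P 0 ->
  (forall t u, P t -> P u -> P (t + u)) ->
  (forall u g v, g \in rels -> P (u * g * v)) ->
  forall t, I t -> P t.
Proof.
move=> P0 PD Pg _ [s [hs ->]]; rewrite big_seq.
by elim/big_ind: _ => // p /hs; apply: Pg.
Qed.

End GeneratedIdeal.

Section KernelByDerivations.
Variables (K : fieldType) (X : finType) (op : X -> X -> X) (c : braiding K X).
Hypothesis cE : forall x y, c x y = - word K [:: op x y; x].
Local Notation T := (tensor K X).
Local Notation word := (@word K X).
Local Notation sderiv := (sderiv op (K := K)).
Local Notation twist := (twist op (K := K)).

(** Words ending in distinct letters are independent, so the terms of the sum
    in [quantum_sym_sderiv] can be separated. *)
Let last_part y : T -> T := linext (fun s =>
  if rev s is z :: s' then if z == y then word (rev s') else 0 else 0).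
HB.instance Definition _ y := GRing.Linear.on (last_part y).

Let last_partM y x t :
  last_part y (t * word [:: x]) = if x == y then t else 0.
Proof.
have -> : (if x == y then t else 0) = (x == y)%:R *: t.
  by case: eqP; rewrite ?scale1r ?scale0r.
move: t; apply: (eq_linear_word (f := last_part y \o rmulT (word [:: x]))
  (g := (x == y)%:R \*: idfun)) => s /=.
rewrite /rmulT -word_cat /last_part linext_word rev_cat /= revK.
by case: eqP; rewrite ?scale1r ?scale0r.
Qed.

Lemma sderiv_ker x t : t \in nichols_ker c -> sderiv x t \in nichols_ker c.
Proof.
move=> /nichols_kerP ht; apply/nichols_kerP => n.
have := ht n.+1; rewrite (quantum_sym_sderiv cE) => /(congr1 (last_part x)).
rewrite linear_sum linear0 (bigD1 x) //= last_partM eqxx big1 ?addr0 // => y.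
by rewrite last_partM => /negbTE ->.
Qed.

Section Ideal.
Variable rels : seq T.
Local Notation I := (ideal_gen rels).

Hypothesis rel_const : forall g, g \in rels -> hcomp 0 g = 0.
Hypothesis rel_sderiv : forall g x, g \in rels -> I (sderiv x g).
Hypothesis rel_twist : forall g x, g \in rels -> I (twist x g).

Lemma ideal_sderiv t x : I t -> I (sderiv x t).
Proof.
move: t; apply: ideal_gen_elim => [|t u It Iu|u g v gr].
- by rewrite linear0; apply: ideal_gen0.
- by rewrite linearD; apply: ideal_genD.
rewrite !sderivM; apply: ideal_genD.
  exact/ideal_genMr/ideal_genMl/ideal_gen_rel.
apply/ideal_genMr/ideal_genD; first by apply/ideal_genMl/rel_sderiv.
exact/ideal_genMl/rel_twist.
Qed.

(** An ideal without constant terms that is stable by all the derivations lies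
    in the kernel of every Q_n, by induction on n. *)
Lemma ideal_sub_ker t : I t -> t \in nichols_ker c.
Proof.
move=> It; apply/nichols_kerP => n; elim: n t It => [|n IHn] t It.
  have -> : hcomp 0 t = 0; last exact: linear0.
  move: t It; apply: ideal_gen_elim => [|t u t0 u0|u g v /rel_const g0].
  - exact: linear0.
  - by rewrite linearD /= t0 u0 addr0.
  - by rewrite !hcomp0M g0 mulr0 mul0r.
rewrite (quantum_sym_sderiv cE) big1 // => x _.
by rewrite IHn ?mul0r //; apply: ideal_sderiv.
Qed.

End Ideal.

Fixpoint sderivs (D : seq X) (t : T) : T :=
  if D is x :: D' then sderivs D' (sderiv x t) else t.

Lemma sderivs_linear D : linear (sderivs D).
Proof. by move=> a t u; elim: D t u => //= x D IHD t u; rewrite linearP IHD. Qed.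
HB.instance Definition _ D :=
  GRing.isLinear.Build K T T _ (sderivs D) (sderivs_linear D).

Lemma sderivs_ker D t : t \in nichols_ker c -> sderivs D t \in nichols_ker c.
Proof. by elim: D t => //= x D IHD t /(sderiv_ker x)/IHD. Qed.

End KernelByDerivations.

(** * Dual sequences of derivations *)

Section DualWords.
Variables (X : finType) (op : X -> X -> X).
Implicit Types (S D w u : seq X).

(** A derivative by x of a word with letters in S has letters in this set. *)
Definition spread S x := S ++ map (op x) S.

(** A sufficient condition for D to annihilate u w for all words u with letters
    in S. By the Leibniz rule each derivation of D acts on one of the two
    factors; the condition asks that all the branches of this expansion stop,
    necessarily at a derivation of the factor u by a letter that cannot occur
    in it. No cancellation between branches is taken into account. *)
Fixpoint dies S D w : bool :=
  if D is x :: D' then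
    ((x \in S) ==> dies (spread S x) D' (map (op x) w)) &&
    all (fun m => dies S D' m.2) (word_sderiv op x w)
  else false.

(** Likewise, a sufficient condition for the value of D on u w to be u times
    its value on w: only the branch in which all the derivations act on w may
    survive. *)
Fixpoint passes S D w : bool :=
  if D is x :: D' then
    ((x \in S) ==> dies (spread S x) D' (map (op x) w)) &&
    all (fun m => passes S D' m.2) (word_sderiv op x w)
  else true.

(** The value of D on a word of the same length, which is a constant. *)
Fixpoint eps D w : int :=
  if D is x :: D' then
    foldr (fun m => +%R (m.1 * eps D' m.2)) 0 (word_sderiv op x w)
  else 1.

(** The pairs consist of a word and its sequence of derivations. A sequence has
    to separate its word from the later words of the list only, because
    the earlier ones have already been eliminated when it is used. *)
Fixpoint dual_words S (ds : seq (seq X * seq X)) : bool :=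
  if ds is d :: ds' then
    [&& passes S d.2 d.1, size d.1 == size d.2, eps d.2 d.1 \in [:: 1; -1],
      all (fun d' => [&& passes S d.2 d'.1, (size d'.1 <= size d.2)%N &
             (size d'.1 < size d.2)%N || (eps d.2 d'.1 == 0)]) ds'
      & dual_words S ds']
  else true.

Variable K : fieldType.
Local Notation T := (tensor K X).
Local Notation word := (@word K X).
Local Notation sderiv := (sderiv op (K := K)).
Local Notation twist := (twist op (K := K)).
Local Notation sderivs := (sderivs (K := K) op).

Lemma word_sderiv_absent x u : x \notin u -> word_sderiv op x u = [::].
Proof.
elim: u => //= y u IHu; rewrite inE negb_or => /andP[/negbTE -> /IHu ->].
by [].
Qed.

Lemma word_sderiv_spread S x u m : {subset u <= S} -> m \in word_sderiv op x u ->
  {subset m.2 <= spread S x}.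
Proof.
elim: u m => //= y u IHu m uS; rewrite mem_cat => /orP[|/mapP[m' m'u ->]] /=.
  case: ifP => // _; rewrite inE => /eqP -> _ /mapP[z zu ->].
  by rewrite mem_cat map_f ?orbT // uS // inE zu orbT.
move=> z; rewrite inE => /predU1P[->|].
  by rewrite mem_cat uS ?inE ?eqxx.
by apply: IHu m'u z => z zu; rewrite uS // inE zu orbT.
Qed.

Lemma linear_mulsum (A : algType K) (V : lmodType K) (f : {linear A -> V})
    (J : Type) (r : seq J) (a : J -> K) (F : J -> A) (t : A) :
  f (t * \sum_(i <- r) a i *: F i) = \sum_(i <- r) a i *: f (t * F i).
Proof.
rewrite mulr_sumr linear_sum; apply: eq_bigr => i _.
by rewrite -scalerAr linearZ.
Qed.

Lemma linear_summul (A : algType K) (V : lmodType K) (f : {linear A -> V})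
    (J : Type) (r : seq J) (a : J -> K) (F : J -> A) (t : A) :
  f ((\sum_(i <- r) a i *: F i) * t) = \sum_(i <- r) a i *: f (F i * t).
Proof.
rewrite mulr_suml linear_sum; apply: eq_bigr => i _.
by rewrite -scalerAl linearZ.
Qed.

Lemma linear_sderiv (V : lmodType K) (f : {linear T -> V}) x u w :
  f (sderiv x (word u * word w)) =
  \sum_(m <- word_sderiv op x w) m.1%:~R *: f (word u * word m.2) +
  \sum_(m <- word_sderiv op x u) m.1%:~R *: f (word m.2 * twist x (word w)).
Proof.
rewrite sderivM !sderiv_word linearD.
by congr (_ + _); [apply: linear_mulsum | apply: linear_summul].
Qed.

Lemma linear_twist (V : lmodType K) (f : {linear T -> V}) x u w :
  f (word u * word (map (op x) w)) = 0 -> f (word u * twist x (word w)) = 0.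
Proof.
have scaler_f (A : algType K) (h : {linear A -> V}) b t v :
  h (t * (b *: v)) = b *: h (t * v) by rewrite -scalerAr linearZ.
by move=> f0; rewrite twist_word scaler_f f0 scaler0.
Qed.

Lemma dies_sound S D w u : {subset u <= S} -> dies S D w ->
  sderivs D (word u * word w) = 0.
Proof.
elim: D S w u => //= x D IHD S w u uS /andP[/implyP hS /allP hw].
rewrite (linear_sderiv (sderivs D)) big_seq big1 ?add0r => [|m /hw mw].
  have [xu|xu] := boolP (x \in u); last by rewrite word_sderiv_absent // big_nil.
  rewrite big_seq big1 // => m mu; rewrite linear_twist ?scaler0 //=.
  apply: (IHD (spread S x)); last exact/hS/uS.
  exact: word_sderiv_spread uS mu.
by rewrite /= (IHD S) ?scaler0.
Qed.

Lemma passes_sound S D w u : {subset u <= S} -> passes S D w ->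
  sderivs D (word u * word w) = word u * sderivs D (word w).
Proof.
move=> uS; elim: D w => //= x D IHD w /andP[/implyP hS /allP hw].
rewrite (linear_sderiv (sderivs D)) [X in _ + X](_ : _ = 0) ?addr0.
  rewrite sderiv_word (linear_sum (sderivs D)) mulr_sumr big_seq [RHS]big_seq.
  apply: eq_bigr => m /hw mw; rewrite /= IHD // linearZ_LR.
  exact: scalerAr.
have [xu|xu] := boolP (x \in u); last by rewrite word_sderiv_absent // big_nil.
rewrite big_seq big1 // => m mu; rewrite linear_twist ?scaler0 //=.
apply: (@dies_sound (spread S x)); last exact/hS/uS.
exact: word_sderiv_spread uS mu.
Qed.

Lemma sderivs_short D w : (size w < size D)%N -> sderivs D (word w) = 0.
Proof.
elim: D w => //= x D IHD w wD.
rewrite sderiv_word (linear_sum (sderivs D)) big_seq big1 // => m.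
move=> /size_word_sderiv mw.
by rewrite linearZ_LR /= IHD ?scaler0 // -ltnS mw.
Qed.

Lemma foldr_scale (V : lmodType K) (v : V) (f : seq X -> int) (p : wpoly X) :
  \sum_(m <- p) m.1%:~R *: ((f m.2)%:~R *: v) =
  (foldr (fun m => +%R (m.1 * f m.2)) 0 p)%:~R *: v.
Proof.
elim: p => [|m p IHp]; first by rewrite big_nil scale0r.
by rewrite big_cons IHp /= intrD intrM scalerDl scalerA.
Qed.

Lemma eps_sound D w : size w = size D ->
  sderivs D (word w) = (eps D w)%:~R%:A.
Proof.
elim: D w => [|x D IHD] w /=; first by move=> /size0nil ->; rewrite word1 scale1r.
move=> wD; rewrite sderiv_word (linear_sum (sderivs D)) -foldr_scale.
rewrite big_seq [RHS]big_seq; apply: eq_bigr => m /size_word_sderiv mw.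
rewrite linearZ_LR /= IHD //.
by apply: succn_inj; rewrite mw.
Qed.

Variable c : braiding K X.
Hypothesis cE : forall x y, c x y = - word [:: op x y; x].

(** The sequence dual to the first word extracts its coefficient, up to sign,
    from the sum; as the derivations preserve the kernel, this coefficient lies
    in the kernel, the corresponding term can be removed from the sum, and the
    next sequence applies to what remains. *)
Lemma dual_words_ker S (ds : seq (seq X * seq X)) (U : seq (seq X))
    (a : seq X -> seq X -> K) :
  dual_words S ds -> (forall u, u \in U -> {subset u <= S}) ->
  \sum_(d <- ds) (\sum_(u <- U) a u d.1 *: word u) * word d.1
    \in nichols_ker c ->
  forall d, d \in ds -> \sum_(u <- U) a u d.1 *: word u \in nichols_ker c.
Proof.
move=> + US; elim: ds => //= d ds IHds /and5P[dS /eqP dd ed /allP dds dual].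
set t := fun w => \sum_(u <- U) a u w *: word u.
have derivs_t w : passes S d.2 w ->
    sderivs d.2 (t w * word w) = t w * sderivs d.2 (word w).
  move=> pw; rewrite (linear_summul (sderivs d.2)).
  apply: esym; apply: (etrans (linear_summul (@idfun T) _ _ _ _)).
  rewrite big_seq [RHS]big_seq.
  by apply: eq_bigr => u /US uS; rewrite /= (passes_sound uS).
have derivs_eps w : passes S d.2 w -> size w = size d.2 ->
    sderivs d.2 (t w * word w) = (eps d.2 w)%:~R *: t w.
  by move=> pw wd; rewrite derivs_t // (eps_sound wd); apply: mulr_algr.
rewrite big_cons => ht.
have {}ht : t d.1 * word d.1 + \sum_(d' <- ds) t d'.1 * word d'.1
  \in nichols_ker c by [].
have td : t d.1 \in nichols_ker c.
  have := sderivs_ker cE d.2 ht; rewrite (linearD (sderivs d.2)).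
  rewrite (linear_sum (sderivs d.2)) /= (derivs_eps _ dS dd) big_seq big1 => [|d'].
    rewrite addr0 => /(nichols_kerZ (eps d.2 d.1)%:~R).
    suff e1 : (eps d.2 d.1)%:~R * (eps d.2 d.1)%:~R = 1 :> K.
      by rewrite scalerA e1 scale1r.
    by move: ed; rewrite !inE => /orP[] /eqP ->; rewrite ?rmorphN1 ?mulrNN mulr1.
  move=> /dds /and3P[pd' le lt].
  case/orP: lt => [lt|/eqP e0]; first by rewrite derivs_t // sderivs_short ?mulr0.
  move: le; rewrite leq_eqVlt => /orP[/eqP eq|lt].
    by rewrite derivs_eps // e0 scale0r.
  by rewrite derivs_t // sderivs_short ?mulr0.
move=> d'; rewrite inE => /predU1P[-> //|]; apply: IHds => //.
have := rpredB ht (nichols_kerMr (word d.1) td).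
by rewrite addrC addKr.
Qed.

End DualWords.

(** * Rewriting modulo an ideal *)

Section Rewriting.
Variables X : finType.
Implicit Types (s u v : seq X) (p q : wpoly X).

Definition rule : Type := seq X * wpoly X.
Implicit Types (r : rule) (rs : seq rule).

Definition relation_of r : wpoly X := (1, r.1) :: scalep (-1) r.2.

Fixpoint add_term (m : int * seq X) p : wpoly X :=
  if p is n :: p' then
    if n.2 == m.2 then
      if n.1 + m.1 == 0 then p' else (n.1 + m.1, n.2) :: p'
    else n :: add_term m p'
  else [:: m].

(** Gathers equal words and drops zero coefficients, so that an element is seen
    to vanish when all its terms cancel. *)
Definition collect p : wpoly X := foldr add_term [::] p.

Fixpoint rewrite_prefix rs s : option (wpoly X) :=
  if rs is r :: rs' then
    if prefix r.1 s then Some [seq (m.1, m.2 ++ drop (size r.1) s) | m <- r.2]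
    else rewrite_prefix rs' s
  else None.

(** The two extreme places at which a word can be rewritten. Leftmost rewriting
    computes normal forms; its divergence from rightmost rewriting on a
    critical word produces the new rules. *)
Fixpoint leftmost rs s : option (wpoly X) :=
  if rewrite_prefix rs s is Some p then Some p
  else if s is y :: s' then omap (consp y) (leftmost rs s') else None.

Fixpoint rightmost rs s : option (wpoly X) :=
  if s is y :: s' then
    if rightmost rs s' is Some p then Some (consp y p) else rewrite_prefix rs s
  else rewrite_prefix rs s.

(** All the terms are rewritten at once, so that few rounds suffice. *)
Definition rewrite_terms (strategy : seq X -> option (wpoly X)) p : wpoly X :=
  collect (flatten [seq (if strategy m.2 is Some q then scalep m.1 q
                         else [:: m]) | m <- p]).

Definition reduce strategy n p := iter n (rewrite_terms strategy) p.

Variables (K : fieldType) (rels : seq (tensor K X)).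
Local Notation T := (tensor K X).
Local Notation word := (@word K X).
Local Notation eval := (eval K).
Local Notation I := (ideal_gen rels).

Lemma eval_relation_of r : eval (relation_of r) = word r.1 - eval r.2.
Proof. by rewrite eval_cons eval_scalep /= scale1r scaleN1r. Qed.

Lemma sum_add_term (V : lmodType K) (F : seq X -> V) m p :
  \sum_(n <- add_term m p) n.1%:~R *: F n.2 =
  m.1%:~R *: F m.2 + \sum_(n <- p) n.1%:~R *: F n.2.
Proof.
elim: p => [|n p IHp] /=; first by rewrite big_seq1 big_nil addr0.
case: eqP => [<-|_]; last by rewrite !big_cons IHp addrCA.
rewrite big_cons addrA -scalerDl -intrD [m.1 + _]addrC.
case: eqP => [->|_]; first by rewrite scale0r add0r.
by rewrite big_cons.
Qed.

Lemma eval_collect p : eval (collect p) = eval p.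
Proof.
elim: p => //= m p IHp; apply: etrans (sum_add_term word m _) _.
by rewrite eval_cons -IHp.
Qed.

Lemma eval_Mword p v : eval [seq (m.1, m.2 ++ v) | m <- p] = eval p * word v.
Proof.
elim: p => [|m p IHp]; first by rewrite eval_nil mul0r.
by rewrite /= !eval_cons mulrDl IHp -scalerAl word_cat.
Qed.

Definition sound r := I (word r.1 - eval r.2).

Definition sound_strategy strategy :=
  forall s p, strategy s = Some p -> I (word s - eval p).

Section Sound.
Variable rs : seq rule.
Hypothesis rs_sound : forall r, r \in rs -> sound r.

Lemma rewrite_prefix_sound : sound_strategy (rewrite_prefix rs).
Proof.
move=> s p; elim: rs rs_sound => //= r rs' IHrs h.
case: ifP => [/prefixP[v ->] [<-]|_]; last first.
  by apply: IHrs => r' r's; apply: h; rewrite inE r's orbT.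
rewrite drop_size_cat // eval_Mword word_cat -mulrBl; apply: ideal_genMr.
by apply: h; rewrite inE eqxx.
Qed.

Lemma consp_sound y s p :
  I (word s - eval p) -> I (word (y :: s) - eval (consp y p)).
Proof.
by rewrite eval_consp -[y :: s]cat1s word_cat -mulrBr; apply: ideal_genMl.
Qed.

Lemma leftmost_sound : sound_strategy (leftmost rs).
Proof.
have h := rewrite_prefix_sound; elim=> [|y s IHs] p /=.
  by case e: rewrite_prefix => [q|//] [<-]; apply: h.
case e: rewrite_prefix => [q|]; first by move=> [<-]; apply: h.
by case e': (leftmost rs s) => [q|//] [<-]; apply/consp_sound/IHs.
Qed.

Lemma rightmost_sound : sound_strategy (rightmost rs).
Proof.
elim=> [|y s IHs] p /=; first exact: rewrite_prefix_sound.
case e: (rightmost rs s) => [q|]; last exact: rewrite_prefix_sound.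
by move=> [<-]; apply/consp_sound/IHs.
Qed.

End Sound.

Lemma reduce_sound strategy n p : sound_strategy strategy ->
  I (eval p - eval (reduce strategy n p)).
Proof.
move=> h; elim: n => [|n IHn]; first by rewrite subrr; apply: ideal_gen0.
apply: ideal_gen_trans IHn _; rewrite /reduce iterS.
move: (iter n _ p) => {}p; rewrite /rewrite_terms eval_collect.
elim: p => [|m p IHp] /=; first by rewrite subrr; apply: ideal_gen0.
rewrite eval_cons eval_cat opprD addrACA; apply: ideal_genD => //.
case e: (strategy m.2) => [q|]; last first.
  by rewrite eval_cons eval_nil addr0 subrr; apply: ideal_gen0.
by rewrite eval_scalep -scalerBr; apply/ideal_genZ/h.
Qed.

End Rewriting.

Section TermwiseOperations.
Variables (X : finType) (op : X -> X -> X) (K : fieldType).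
Implicit Types (x : X) (p : wpoly X).
Local Notation eval := (eval K).

Definition sderiv_terms x p : wpoly X :=
  flatten [seq scalep m.1 (word_sderiv op x m.2) | m <- p].

Definition twist_terms x p : wpoly X :=
  [seq (m.1 * (-1) ^+ size m.2, map (op x) m.2) | m <- p].

Lemma eval_sderiv_terms x p : eval (sderiv_terms x p) = sderiv op x (eval p).
Proof.
elim: p => [|m p IHp]; first by rewrite eval_nil linear0.
rewrite [sderiv_terms _ _]/= eval_cat IHp eval_scalep eval_cons linearP.
by rewrite /= sderiv_word.
Qed.

Lemma eval_twist_terms x p : eval (twist_terms x p) = twist op x (eval p).
Proof.
rewrite /eval linear_sum big_map; apply: eq_bigr => m _.
rewrite linearZ_LR /= twist_word intrM rmorphXn rmorphN1.
exact/esym/scalerA.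
Qed.

Lemma hcomp0_eval p : all (fun m => m.2 != [::]) p -> hcomp 0 (eval p) = 0.
Proof.
move=> /allP p0; rewrite linear_sum big_seq big1 // => m /p0.
by rewrite linearZ_LR /= hcomp_word -size_eq0 => /negbTE ->; apply: scaler0.
Qed.

End TermwiseOperations.

Section CriticalWords.
Variable X : finType.
Implicit Types (rs : seq (rule X)) (d : seq X * rule X).

(** A new rule d.2 comes with a critical word d.1, in which the left-hand sides
    of two former rules overlap. Reducing that word from the left and from the
    right gives two congruent elements; that their difference is the new
    relation, up to sign, proves it. *)
Definition justified n rs d : bool :=
  let p := reduce (leftmost rs) n [:: (1, d.1)] ++
    scalep (-1) (reduce (rightmost rs) n [:: (1, d.1)]) in
  (collect (p ++ relation_of d.2) == [::]) ||
  (collect (p ++ scalep (-1) (relation_of d.2)) == [::]).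

Fixpoint completion n rs (ds : seq (seq X * rule X)) : bool :=
  if ds is d :: ds' then justified n rs d && completion n (d.2 :: rs) ds'
  else true.

Variables (K : fieldType) (rels : seq (tensor K X)).
Local Notation I := (ideal_gen rels).

Lemma completion_sound n rs ds : completion n rs ds ->
  (forall r, r \in rs -> sound rels r) ->
  forall r, r \in map snd ds ++ rs -> sound rels r.
Proof.
elim: ds rs => //= d ds IHds rs /andP[jd jds] rs_sound.
have hl := leftmost_sound rs_sound; have hr := rightmost_sound rs_sound.
suff d_sound : sound rels d.2.
  move=> r; rewrite inE mem_cat orbCA => rin; apply: (IHds _ jds) => [r'|].
    by rewrite inE => /predU1P[->|/rs_sound].
  by rewrite mem_cat inE.
have : I (eval K (reduce (leftmost rs) n [:: (1, d.1)] ++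
    scalep (-1) (reduce (rightmost rs) n [:: (1, d.1)]))).
  rewrite eval_cat eval_scalep scaleN1r -opprB; apply: ideal_genN.
  apply: (ideal_gen_trans (u := eval K [:: (1, d.1)])).
    by rewrite -opprB; apply/ideal_genN/reduce_sound.
  exact: reduce_sound.
rewrite /sound -eval_relation_of; move: jd; rewrite /justified.
move: (_ ++ scalep _ _) => p jd Ip.
have {jd}[] := orP jd => /eqP/(congr1 (eval K));
  rewrite eval_collect eval_nil eval_cat.
  move/eqP; rewrite addr_eq0 => /eqP pE; rewrite -[eval K _]opprK -pE.
  exact: ideal_genN.
by rewrite eval_scalep scaleN1r => /eqP; rewrite subr_eq0 => /eqP <-.
Qed.

End CriticalWords.

Section Spanning.
Variables (K : fieldType) (X : finType) (rels : seq (tensor K X)).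
Local Notation T := (tensor K X).
Local Notation word := (@word K X).
Local Notation I := (ideal_gen rels).

Definition spanned (W : seq (seq X)) (t : T) : Prop :=
  exists a : seq X -> K, I (t - \sum_(w <- W) a w *: word w).

Lemma spanned_congr W t u : I (t - u) -> spanned W u -> spanned W t.
Proof. by move=> tu [a h]; exists a; apply: ideal_gen_trans tu h. Qed.

Lemma spannedD W t u : spanned W t -> spanned W u -> spanned W (t + u).
Proof.
move=> [a ha] [b hb]; exists (fun w => a w + b w).
rewrite (eq_bigr _ (fun w _ => scalerDl (word w) (a w) (b w))) big_split.
by have := ideal_genD ha hb; rewrite addrACA -opprD.
Qed.

Lemma spannedZ W k t : spanned W t -> spanned W (k *: t).
Proof.
move=> [a ha]; exists (fun w => k * a w).
rewrite (eq_bigr _ (fun w _ => esym (scalerA k (a w) (word w)))) -scaler_sumr.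
by have := ideal_genZ k ha; rewrite scalerBr.
Qed.

Lemma spanned_sum W (J : eqType) (r : seq J) (b : J -> K) (F : J -> T) :
  (forall j, j \in r -> spanned W (F j)) ->
  spanned W (\sum_(j <- r) b j *: F j).
Proof.
move=> h; rewrite big_seq; apply: big_ind => [|t u|j /h]; last exact: spannedZ.
  exists (fun=> 0); rewrite big1 ?subr0; first exact: ideal_gen0.
  by move=> w _; apply: scale0r.
exact: spannedD.
Qed.

Lemma spanned_word W w : uniq W -> w \in W -> spanned W (word w).
Proof.
move=> uW wW; exists (fun v => (v == w)%:R); rewrite (bigD1_seq w) //= eqxx.
rewrite scale1r big1 ?addr0 ?subrr; first exact: ideal_gen0.
by move=> v /negbTE ->; apply: scale0r.
Qed.

(** Applied below to right multiplications. *)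
Lemma linear_spanned (f : {linear T -> T}) W W' :
  (forall t, I t -> I (f t)) ->
  (forall w, w \in W -> spanned W' (f (word w))) ->
  forall t, spanned W t -> spanned W' (f t).
Proof.
move=> fI fW t [a /fI]; rewrite linearB linear_sum => /spanned_congr; apply.
rewrite (eq_bigr (fun w => a w *: f (word w))) => [|w _]; last exact: linearZ.
exact: spanned_sum.
Qed.

End Spanning.

(** * Rules, rows and dual sequences for the affine crossed set *)

Definition affine5_letters : seq 'Z_5 := [:: 0; 1; 2; 3; 4].

(** The defining relations, solved for their greatest words. *)
Definition affine5_basic_rules : seq (rule 'Z_5) := [::
  ([:: 0; 0], [::]); ([:: 1; 1], [::]); ([:: 2; 2], [::]);
  ([:: 3; 3], [::]); ([:: 4; 4], [::]);
  ([:: 3; 2], [:: (-1, [:: 2; 0]); (-1, [:: 1; 3]); (-1, [:: 0; 1])]);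
  ([:: 4; 0], [:: (-1, [:: 2; 1]); (-1, [:: 1; 4]); (-1, [:: 0; 2])]);
  ([:: 4; 1], [:: (-1, [:: 3; 4]); (-1, [:: 1; 0]); (-1, [:: 0; 3])]);
  ([:: 4; 2], [:: (-1, [:: 3; 0]); (-1, [:: 2; 3]); (-1, [:: 0; 4])]);
  ([:: 4; 3], [:: (-1, [:: 3; 1]); (-1, [:: 2; 4]); (-1, [:: 1; 2])]);
  ([:: 1; 0; 1; 0], [:: (-1, [:: 0; 1; 0; 1])])].

(** The other elements of a Groebner basis, each with a critical word from
    which it arises. *)
Definition affine5_completion : seq (seq 'Z_5 * rule 'Z_5) := [::
  ([:: 3; 2; 2], ([:: 2; 0; 2],
    [:: (1, [:: 1; 2; 0]); (1, [:: 1; 0; 1]); (-1, [:: 0; 1; 2])]));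
  ([:: 3; 3; 2], ([:: 3; 1; 3],
    [:: (-1, [:: 3; 0; 1]); (1, [:: 1; 3; 0]); (1, [:: 0; 1; 0])]));
  ([:: 4; 0; 0], ([:: 2; 1; 0],
    [:: (1, [:: 1; 2; 1]); (1, [:: 1; 0; 2]); (-1, [:: 0; 2; 0])]));
  ([:: 4; 1; 1], ([:: 3; 1; 0],
    [:: (-1, [:: 3; 0; 3]); (1, [:: 1; 0; 1]); (1, [:: 0; 3; 1])]));
  ([:: 4; 2; 2], ([:: 3; 0; 2],
    [:: (1, [:: 2; 1; 3]); (1, [:: 2; 0; 1]); (1, [:: 0; 3; 0]);
        (1, [:: 0; 2; 3])]));
  ([:: 4; 3; 3], ([:: 3; 0; 1],
    [:: (-1, [:: 2; 3; 1]); (-1, [:: 2; 1; 2]); (1, [:: 1; 3; 0]);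
        (1, [:: 1; 2; 3]); (1, [:: 0; 1; 0])]));
  ([:: 2; 2; 0; 2], ([:: 2; 1; 2; 0],
    [:: (1, [:: 2; 0; 1; 2]); (-1, [:: 1; 0; 2; 1]); (1, [:: 0; 2; 0; 1])]));
  ([:: 2; 2; 1; 0], ([:: 2; 1; 2; 1], [:: (-1, [:: 1; 2; 1; 2])]));
  ([:: 3; 1; 0; 0], ([:: 3; 0; 3; 0], [:: (-1, [:: 0; 3; 0; 3])]));
  ([:: 3; 1; 3; 2], ([:: 3; 1; 2; 0],
    [:: (1, [:: 3; 0; 3; 1]); (-1, [:: 2; 3; 1; 2]); (-1, [:: 1; 2; 1; 3]);
        (-1, [:: 1; 2; 0; 1])]));
  ([:: 3; 2; 1; 0], ([:: 3; 1; 2; 1],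
    [:: (-1, [:: 2; 0; 1; 0]); (-1, [:: 1; 0; 3; 1]); (-1, [:: 1; 0; 1; 2]);
        (-1, [:: 0; 3; 1; 2]); (-1, [:: 0; 1; 0; 3])]));
  ([:: 3; 3; 0; 1], ([:: 3; 1; 2; 3],
    [:: (-1, [:: 2; 0; 3; 1]); (-1, [:: 2; 0; 1; 2]); (-1, [:: 1; 3; 1; 2]);
        (-1, [:: 0; 1; 3; 1])]));
  ([:: 2; 0; 2; 0; 2], ([:: 2; 0; 1; 2; 0], [:: (-1, [:: 2; 0; 1; 0; 1])]));
  ([:: 2; 0; 2; 1; 0], ([:: 2; 0; 1; 2; 1],
    [:: (-1, [:: 2; 0; 1; 0; 2]); (1, [:: 1; 2; 0; 1; 0]);
        (1, [:: 0; 1; 0; 2; 0])]));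
  ([:: 2; 1; 0; 1; 0], ([:: 2; 0; 1; 0; 1],
    [:: (-1, [:: 1; 0; 1; 2; 1]); (1, [:: 0; 2; 0; 1; 0]);
        (1, [:: 0; 1; 0; 1; 2])]));
  ([:: 2; 0; 1; 2; 1; 1], ([:: 2; 0; 1; 0; 2; 1],
    [:: (1, [:: 1; 0; 2; 0; 1; 0]); (1, [:: 0; 1; 0; 2; 0; 1])]));
  ([:: 2; 0; 1; 2; 1; 2; 0], ([:: 2; 0; 1; 0; 2; 0; 1],
    [:: (1, [:: 1; 2; 0; 1; 0; 2; 0])]))].

Definition affine5_rules : seq (rule 'Z_5) :=
  map snd affine5_completion ++ affine5_basic_rules.

(** A number of rounds sufficient for all the reductions below. *)
Definition affine5_fuel := 8%N.

Definition affine5_reduce := reduce (leftmost affine5_rules) affine5_fuel.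

Lemma affine5_completion_ok :
  completion affine5_fuel affine5_basic_rules affine5_completion.
Proof. by vm_compute. Qed.

Lemma affine5_rels_stable : all (fun r => all (fun x =>
    (affine5_reduce (sderiv_terms affine5_op x (relation_of r)) == [::]) &&
    (affine5_reduce (twist_terms affine5_op x (relation_of r)) == [::]))
  affine5_letters) affine5_basic_rules.
Proof. by vm_compute. Qed.

Definition below k (s : seq 'Z_5) := all (fun x : 'Z_5 => (x < k)%N) s.

(** The words v r' with r' in row k and v in the letters smaller than k; in the
    products of r and x below, all terms of the normal form have this shape. *)
Definition straightened k (s : seq 'Z_5) := has (fun r => suffix r s &&
  below k (take (size s - size r) s)) (nth [::] affine5_rows k).

Lemma affine5_straightens : all (fun k => all (fun r => all (fun x : 'Z_5 =>
    (x <= k)%N ==> all (fun m => straightened k m.2)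
      (affine5_reduce [:: (1, rcons r x)]))
  affine5_letters) (nth [::] affine5_rows k)) (iota 0 5).
Proof. by vm_compute. Qed.

(** For each row, its words in order of decreasing length with their dual
    sequences. Within a row these sequences are the prefixes of one or two of
    them: 143 for row 1, 2324 and 124342 for row 2, 343 and 03434 for
    row 3. *)
Definition affine5_duals : seq (seq (seq 'Z_5 * seq 'Z_5)) := [::
  [:: ([:: 0], [:: 0]); ([::], [::])];
  [:: ([:: 1; 0; 1], [:: 1; 4; 3]); ([:: 1; 0], [:: 1; 4]); ([:: 1], [:: 1]);
      ([::], [::])];
  [:: ([:: 2; 0; 1; 0; 2; 0], [:: 1; 2; 4; 3; 4; 2]);
      ([:: 2; 0; 1; 0; 2], [:: 1; 2; 4; 3; 4]);
      ([:: 2; 0; 1; 2], [:: 1; 2; 4; 3]); ([:: 2; 0; 1; 0], [:: 2; 3; 2; 4]);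
      ([:: 2; 1; 2], [:: 1; 2; 4]); ([:: 2; 0; 1], [:: 2; 3; 2]);
      ([:: 2; 1], [:: 1; 2]); ([:: 2; 0], [:: 2; 3]); ([:: 2], [:: 2]);
      ([::], [::])];
  [:: ([:: 3; 0; 3; 1; 2], [:: 0; 3; 4; 3; 4]);
      ([:: 3; 0; 3; 1], [:: 0; 3; 4; 3]); ([:: 3; 0; 3], [:: 0; 3; 4]);
      ([:: 3; 1; 2], [:: 3; 4; 3]); ([:: 3; 0], [:: 0; 3]);
      ([:: 3; 1], [:: 3; 4]); ([:: 3], [:: 3]); ([::], [::])];
  [:: ([:: 4], [:: 4]); ([::], [::])]].

Lemma affine5_duals_ok : all (fun k =>
    dual_words affine5_op (take k affine5_letters) (nth [::] affine5_duals k) &&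
    perm_eq (nth [::] affine5_rows k) (map fst (nth [::] affine5_duals k)))
  (iota 0 5).
Proof. by vm_compute. Qed.

(** Folding from the left makes the last row the outermost one, which is the
    one that both spanning and independence peel off. *)
Definition row_words (rows : seq (seq (seq 'Z_5))) : seq (seq 'Z_5) :=
  foldl (fun W R => [seq u ++ r | u <- W, r <- R]) [:: [::]] rows.

Definition normal_words k := row_words (take k affine5_rows).

Lemma normal_wordsS k : (k < 5)%N -> normal_words k.+1 =
  [seq u ++ r | u <- normal_words k, r <- nth [::] affine5_rows k].
Proof.
by move=> k5; rewrite /normal_words (take_nth [::]) // /row_words foldl_rcons.
Qed.

Lemma normal_words_below :
  all (fun k => all (below k) (normal_words k)) (iota 0 6).
Proof. by vm_compute. Qed.

Lemma normal_words_size :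
  (size (normal_words 5) == 1280) &&
  all (fun w => size w <= 16)%N (normal_words 5).
Proof. by vm_compute. Qed.
Definition integral_word : seq 'Z_5 :=
  [:: 0; 1; 0; 1; 2; 0; 1; 0; 2; 0; 3; 0; 3; 1; 2; 4].

Lemma integral_word_normal : integral_word \in normal_words 5.
Proof. by vm_compute. Qed.

Lemma normal_words_uniq : all (fun k => uniq (normal_words k)) (iota 0 6).
Proof. by vm_compute. Qed.

Section Affine5.
Variable K : fieldType.
Local Notation T := (tensor K 'Z_5).
Local Notation word := (@word K 'Z_5).
Local Notation eval := (eval K).
Local Notation I := (ideal_gen (affine5_rels K)).
Local Notation spanned := (spanned (affine5_rels K)).
Local Notation c := (affine5 K).

Lemma mem_affine5_letters x : x \in affine5_letters.
Proof. by case: x => [[|[|[|[|[|//]]]]] ?]. Qed.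

Lemma affine5E x y : c x y = - word [:: affine5_op x y; x].
Proof. by []. Qed.

Lemma affine5_relsE :
  affine5_rels K = [seq eval (relation_of r) | r <- affine5_basic_rules].
Proof.
(* The relations are sums of words, so the terms carry no sign. *)
pose ones (ws : seq (seq 'Z_5)) : wpoly 'Z_5 := [seq (1, w) | w <- ws].
have eval_ones ws : eval (ones ws) = \sum_(w <- ws) word w.
  by rewrite /eval big_map; apply: eq_bigr => w _; apply: scale1r.
pose words : seq (seq (seq 'Z_5)) := [::
  [:: [:: 0; 0]]; [:: [:: 1; 1]]; [:: [:: 2; 2]]; [:: [:: 3; 3]];
  [:: [:: 4; 4]];
  [:: [:: 3; 2]; [:: 2; 0]; [:: 1; 3]; [:: 0; 1]];
  [:: [:: 4; 0]; [:: 2; 1]; [:: 1; 4]; [:: 0; 2]];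
  [:: [:: 4; 1]; [:: 3; 4]; [:: 1; 0]; [:: 0; 3]];
  [:: [:: 4; 2]; [:: 3; 0]; [:: 2; 3]; [:: 0; 4]];
  [:: [:: 4; 3]; [:: 3; 1]; [:: 2; 4]; [:: 1; 2]];
  [:: [:: 1; 0; 1; 0]; [:: 0; 1; 0; 1]]].
have -> : [seq eval (relation_of r) | r <- affine5_basic_rules] =
    [seq \sum_(w <- ws) word w | ws <- words].
  rewrite -(eq_map eval_ones) (map_comp eval) [in RHS](map_comp eval).
  by congr (map _ _); apply/eqP; vm_compute.
have sum1 u : word u = \sum_(w <- [:: u]) word w by rewrite big_seq1.
have sum2 u v : word u + word v = \sum_(w <- [:: u; v]) word w.
  by rewrite big_cons big_seq1.
have sum4 s t u v : word s + word t + word u + word v =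
    \sum_(w <- [:: s; t; u; v]) word w.
  by rewrite 3!big_cons big_seq1 !addrA.
by do !congr (_ :: _).
Qed.

Lemma affine5_rules_sound r : r \in affine5_rules -> sound (affine5_rels K) r.
Proof.
apply: (completion_sound affine5_completion_ok) => {}r rb.
rewrite /sound -eval_relation_of; apply: ideal_gen_rel.
rewrite affine5_relsE.
exact: (map_f (fun r => eval (relation_of r))) rb.
Qed.

Lemma affine5_reduce_sound p : I (eval p - eval (affine5_reduce p)).
Proof. exact: reduce_sound (leftmost_sound affine5_rules_sound). Qed.

(** The derivatives and the twists of the relations reduce to zero. *)
Lemma affine5_ideal_sub_ker t : I t -> t \in nichols_ker c.
Proof.
have stable r x : r \in affine5_basic_rules ->
    (affine5_reduce (sderiv_terms affine5_op x (relation_of r)) == [::]) &&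
    (affine5_reduce (twist_terms affine5_op x (relation_of r)) == [::]).
  by move=> rb; have /allP/(_ r rb)/allP/(_ x) := affine5_rels_stable;
    apply; apply: mem_affine5_letters.
have relP g : g \in affine5_rels K ->
    exists2 r, r \in affine5_basic_rules & g = eval (relation_of r).
  by rewrite affine5_relsE => /mapP[r rb ->]; exists r.
have ideal_of_reduce p : affine5_reduce p == [::] -> I (eval p).
  by move=> /eqP p0; have := affine5_reduce_sound p; rewrite p0 eval_nil subr0.
apply: (ideal_sub_ker (affine5E)) => [g|g x|g x] /relP[r rb ->].
- apply: hcomp0_eval; have : all (fun r => all (fun m => m.2 != [::])
    (relation_of r)) affine5_basic_rules by vm_compute.
  by move=> /allP/(_ r rb).
- have /andP[/ideal_of_reduce + _] := stable r x rb.
  by rewrite eval_sderiv_terms.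
- have /andP[_ /ideal_of_reduce] := stable r x rb.
  by rewrite eval_twist_terms.
Qed.

(** * Spanning *)

Lemma straighten k r (x : 'Z_5) : (k < 5)%N -> r \in nth [::] affine5_rows k ->
  (x <= k)%N -> exists2 p, I (word (rcons r x) - eval p) &
    forall m, m \in p -> exists v r', [/\ m.2 = v ++ r', below k v &
      r' \in nth [::] affine5_rows k].
Proof.
move=> k5 rR xk; exists (affine5_reduce [:: (1, rcons r x)]).
  by rewrite -[word _]eval1; apply: affine5_reduce_sound.
have k5' : k \in iota 0 5 by rewrite mem_iota.
have /allP/(_ k k5')/allP/(_ r rR)/allP := affine5_straightens.
move=> /(_ x (mem_affine5_letters x)); rewrite xk => /allP h m /h.
case/hasP=> r' r'R /andP[/suffixP[v ->]]; rewrite size_cat addnK take_size_cat //.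
by move=> bv; exists v, r'.
Qed.

(** For u r with r in row k, the product r x is straightened into terms v r';
    by induction u v is spanned by the words of the smaller rows. *)
Lemma spanned_mulr k : (k <= 5)%N -> forall (x : 'Z_5) t, (x < k)%N ->
  spanned (normal_words k) t -> spanned (normal_words k) (t * word [:: x]).
Proof.
elim: k => [//|k IHk] k5 x t; rewrite ltnS => xk.
have {}IHk v t' : below k v -> spanned (normal_words k) t' ->
    spanned (normal_words k) (t' * word v).
  elim/last_ind: v => [|v y IHv]; first by rewrite word1 mulr1.
  rewrite /below all_rcons => /andP[yk /IHv bv] /bv st.
  by rewrite -cats1 word_cat mulrA; apply: IHk => //; apply: ltnW.
have uW j : (j <= 5)%N -> uniq (normal_words j).
  by move=> j5; have /allP := normal_words_uniq; apply; rewrite mem_iota.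
have row r' t' : r' \in nth [::] affine5_rows k ->
    spanned (normal_words k) t' -> spanned (normal_words k.+1) (t' * word r').
  move=> r'R; apply: (linear_spanned (f := rmulT (word r'))) => [u|w wW].
    exact: ideal_genMr.
  rewrite /= /rmulT -word_cat; apply: spanned_word; first exact: uW.
  by rewrite normal_wordsS //; apply/allpairsP; exists (w, r').
apply: (linear_spanned (f := rmulT (word [:: x]))) => [u|w].
  exact: ideal_genMr.
rewrite {1}normal_wordsS // => /allpairsP[[u r] /= [uk rR ->]].
have [p hp ph] := straighten k5 rR xk.
rewrite /rmulT -word_cat -catA cats1 word_cat.
apply: (spanned_congr (u := word u * eval p)).
  by rewrite -mulrBr; apply: ideal_genMl.
have -> : word u * eval p = \sum_(m <- p) m.1%:~R *: (word u * word m.2).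
  exact: (linear_mulsum (@idfun T)).
apply: spanned_sum => m /ph[v [r' [-> bv r'R]]].
rewrite word_cat mulrA; apply: row => //; apply: IHk => //.
by apply: spanned_word => //; apply/uW/ltnW.
Qed.

Lemma spanned_all t : spanned (normal_words 5) t.
Proof.
rewrite [t]tensorE; apply: spanned_sum => m _; move: (m : seq 'Z_5) => s.
elim/last_ind: s => [|s x IHs].
  apply: spanned_word; last by vm_compute.
  by have /allP := normal_words_uniq; apply.
by rewrite -cats1 word_cat; apply: spanned_mulr => //; apply: ltn_ord.
Qed.

(** * Independence *)

(** Grouping the words u r by r gives the sum to which the dual sequences of
    row k apply. *)
Lemma normal_words_free k : (k <= 5)%N -> forall a : seq 'Z_5 -> K,
  \sum_(w <- normal_words k) a w *: word w \in nichols_ker c ->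
  forall w, w \in normal_words k -> a w = 0.
Proof.
elim: k => [_ a|k IHk k5 a].
  rewrite big_seq1 word1 => h w; rewrite inE => /eqP ->.
  apply/eqP/negP => /negP a0; have := nichols_ker1 c; rewrite -[1]scale1r.
  by rewrite -(mulVf a0) -scalerA nichols_kerZ.
have k5' : k \in iota 0 5 by rewrite mem_iota.
have /allP/(_ k k5')/andP[dual perm] := affine5_duals_ok.
rewrite normal_wordsS // big_allpairs_dep exchange_big (perm_big _ perm) big_map /=.
pose b u r := a (u ++ r).
rewrite (eq_bigr (fun d => (\sum_(u <- normal_words k) b u d.1 *: word u) *
  word d.1)) => [h|d _]; last first.
  apply/esym/(etrans (linear_summul (@idfun T) _ _ _ _)).
  by apply: eq_bigr => u _; rewrite word_cat.
have below_letters u : u \in normal_words k ->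
    {subset u <= take k affine5_letters}.
  move=> uk y yu; have k6 : k \in iota 0 6 by rewrite mem_iota; apply: leqW k5.
  have /allP/(_ k k6)/allP/(_ u uk)/allP/(_ y yu) := normal_words_below.
  by case: y {yu} => [[|[|[|[|[|//]]]]] ?];
    case: k k5 {IHk k5' dual perm h uk k6} => [|[|[|[|[|]]]]].
have := dual_words_ker affine5E dual below_letters h => {}h.
move=> _ /allpairsP[[u r] /= [uk rR ->]].
have : r \in map fst (nth [::] affine5_duals k) by rewrite -(perm_mem perm).
case/mapP=> d dk rd; rewrite rd.
exact: (IHk (ltnW k5) (fun u => b u d.1) (h d dk) u uk).
Qed.

(** The row words span modulo the smaller of the two ideals and are independent
    modulo the greater one, so the two coincide. *)
Lemma nichols_ker_ideal t : t \in nichols_ker c <-> I t.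
Proof.
split; last exact: affine5_ideal_sub_ker.
have [a ha] := spanned_all t => ht.
have: \sum_(w <- normal_words 5) a w *: word w \in nichols_ker c.
  rewrite -[X in X \in _](subKr t) rpredB //; exact: affine5_ideal_sub_ker.
move=> /(normal_words_free (leqnn 5)) a0; move: ha.
by rewrite big_seq big1 ?subr0 // => w /a0 ->; apply: scale0r.
Qed.

End Affine5.

(** * The structure of the Nichols algebra *)

Section Conclusion.
Variable K : fieldType.
Local Notation T := (tensor K 'Z_5).
Local Notation word := (@word K 'Z_5).
Local Notation c := (affine5 K).
Local Notation pi := (nichols_pi c).
Local Notation W := (normal_words 5).

Lemma gen_prodE s : gen_prod c s = pi (word s).
Proof.
rewrite /gen_prod; elim: s => [|x s IHs].
  by rewrite big_nil word1 rmorph1.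
by rewrite big_cons IHs -cat1s word_cat rmorphM.
Qed.

Lemma free_evalE t : free_eval (nichols_gen c) t = pi t.
Proof.
rewrite [t]tensorE /free_eval !linear_sum; apply: eq_bigr => m _.
by rewrite !linearZ_LR /= linext_word -/(gen_prod c m) gen_prodE.
Qed.

Lemma nichols_pi0 t : pi t = 0 <-> t \in nichols_ker c.
Proof. by rewrite -(linear0 pi) nichols_piP subr0. Qed.

Lemma nichols_pi_surj (a : nichols c) : exists t, a = pi t.
Proof.
exists (generic_quotient.repr (a : {ideal_quot (nichols_ker c)})).
exact/esym/(generic_quotient.reprK a).
Qed.

Lemma affine5_presented : presented (nichols_gen c) (affine5_rels K).
Proof.
split=> [a|t].
  by have [t ->] := nichols_pi_surj a; exists t; apply: free_evalE.
by rewrite free_evalE nichols_pi0 nichols_ker_ideal.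
Qed.

Lemma uniq_W : uniq W.
Proof. by have /allP := normal_words_uniq; apply. Qed.

Lemma normal_word_notin_ker w : w \in W -> word w \notin nichols_ker c.
Proof.
move=> wW; apply/negP => ker.
suff /(_ w wW) : forall v, v \in W -> (v == w)%:R = 0 :> K.
  by rewrite eqxx; apply/eqP/oner_neq0.
apply: (normal_words_free (leqnn 5)); rewrite (bigD1_seq w) ?uniq_W //=.
rewrite eqxx scale1r big1 => [|v /negbTE ->]; last exact: scale0r.
by rewrite addr0.
Qed.

(** Serves for the whole algebra and for each homogeneous component. *)
Lemma filter_lbasis (P : pred (seq 'Z_5)) (S : nichols c -> Prop) :
  (forall w, P w -> S (gen_prod c w)) ->
  (forall v, S v -> exists a : seq 'Z_5 -> K,
     v = \sum_(w <- W | P w) a w *: gen_prod c w) ->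
  lbasis S [seq gen_prod c w | w <- W & P w].
Proof.
move=> SP PS; set V := filter P W.
have uV : uniq V by rewrite filter_uniq ?uniq_W.
have sumV (F : nat -> seq 'Z_5 -> nichols c) :
    \sum_(i < size V) F i (nth [::] V i) = \sum_(w <- V) F (index w V) w.
  rewrite (big_nth [::]) big_mkord; apply: eq_bigr => i _.
  by rewrite index_uniq.
have sumE (a : nat -> K) :
    \sum_(i < size [seq gen_prod c w | w <- V])
      a i *: [seq gen_prod c w | w <- V]`_i =
    \sum_(w <- V) a (index w V) *: gen_prod c w.
  rewrite size_map -(sumV (fun i w => a i *: gen_prod c w)).
  by apply: eq_bigr => i _; rewrite (nth_map [::]).
split=> [_ /mapP[w + ->]|v /PS[a ->]|a a0].
- by rewrite mem_filter => /andP[/SP].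
- exists (fun i => a (nth [::] V i)).
  rewrite (sumE (fun i => a (nth [::] V i))) -big_filter.
  by apply/esym/eq_big_seq => w wV; rewrite nth_index.
pose b i := if insub i is Some j then a j else 0.
have bE i : b (nat_of_ord i) = a i by rewrite /b valK.
have {a0}: pi (\sum_(w <- W) (if P w then b (index w V) else 0) *: word w) = 0.
  rewrite linear_sum -[RHS]a0.
  rewrite [RHS](eq_bigr _ (fun i _ => congr1 (fun k => k *: _) (esym (bE i)))).
  rewrite (sumE b) big_filter [RHS]big_mkcond; apply: eq_bigr => w _.
  by rewrite linearZ_LR /= gen_prodE; case: ifP => // _; rewrite scale0r.
move=> /nichols_pi0/(normal_words_free (leqnn 5)) h i.
have iV : (i < size V)%N.
  by have := ltn_ord i; move: (nat_of_ord i) => j; rewrite size_map.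
have := mem_nth [::] iV; rewrite mem_filter => /andP[Pi iW].
by have := h _ iW; rewrite Pi index_uniq // bE.
Qed.

Lemma nichols_span t : exists a : seq 'Z_5 -> K,
  t - \sum_(w <- W) a w *: word w \in nichols_ker c.
Proof.
have [a ha] := spanned_all t; exists a.
exact: affine5_ideal_sub_ker.
Qed.

Lemma nichols_piB t u : t - u \in nichols_ker c -> pi t = pi u.
Proof. by move/nichols_piP. Qed.

Lemma row_productsE rows :
  row_products c rows = map (gen_prod c) (row_words rows).
Proof.
rewrite /row_words.
suff h W0 : [seq gen_prod c u * b | u <- W0, b <- row_products c rows] =
    map (gen_prod c) (foldl (fun W R => [seq u ++ r | u <- W, r <- R]) W0 rows).
  rewrite -h /= cats0 /gen_prod big_nil.
  by rewrite (eq_map (fun b => mul1r b)) map_id.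
elim: rows W0 => [|R rows IHrows] W0 /=.
  by elim: W0 => //= u W0 ->; rewrite mulr1.
rewrite -IHrows; elim: W0 => //= u W0 ->; rewrite allpairs_cat; congr (_ ++ _).
elim: R => //= r R IHR; rewrite map_cat IHR -map_comp; congr (_ ++ _).
by apply: eq_map => b /=; rewrite /gen_prod big_cat mulrA.
Qed.

Lemma affine5_basis : lbasis (fun _ => True) (row_products c affine5_rows).
Proof.
rewrite row_productsE -[row_words _]/W -[W]filter_predT.
apply: filter_lbasis => // v _; have [t ->] := nichols_pi_surj v.
have [a /nichols_piB ->] := nichols_span t; exists a.
by rewrite linear_sum; apply: eq_bigr => w _; rewrite linearZ_LR /= gen_prodE.
Qed.

(** The kernel is homogeneous, so a homogeneous element only involves the row
    words of its own degree. *)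
Lemma affine5_comp_basis n : lbasis (@nichols_comp _ _ c n)
  [seq gen_prod c w | w <- W & size w == n].
Proof.
apply: filter_lbasis => [w /eqP <-|v [t ht ->]].
  by exists (word w); [apply: homog_word | apply: gen_prodE].
have [a ha] := nichols_span t; exists a.
have := hcomp_ker n ha; rewrite linearB /= hcomp_id // => /nichols_piB ->.
rewrite !linear_sum [RHS]big_mkcond; apply: eq_bigr => w _.
rewrite !linearZ_LR /= hcomp_word gen_prodE; case: ifP => // _.
by rewrite linear0 scaler0.
Qed.

End Conclusion.

Section Hilbert.

(** The length is additive, so the generating function of the row words is the
    product of those of the rows. *)
Lemma sum_row_words (R : comNzRingType) (rows : seq (seq (seq 'Z_5))) (x : R) :
  \sum_(w <- row_words rows) x ^+ size w =
  \prod_(row <- rows) \sum_(r <- row) x ^+ size r.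
Proof.
elim/last_ind: rows => [|rows row IHrows]; first by rewrite big_seq1 big_nil.
rewrite /row_words foldl_rcons -/(row_words rows) big_allpairs_dep big_rcons.
rewrite -IHrows /= [RHS]mulr_suml; apply: eq_bigr => u _.
rewrite mulr_sumr; apply: eq_bigr => r _.
by rewrite size_cat exprD.
Qed.

Lemma affine5_hilbertE :
  affine5_hilbert = \sum_(w <- normal_words 5) 'X^(size w).
Proof.
rewrite sum_row_words /affine5_rows /affine5_hilbert !big_cons !big_nil /=.
by ring.
Qed.

Lemma coef_affine5_hilbert n :
  affine5_hilbert`_n = (count (fun w => size w == n) (normal_words 5))%:Z.
Proof.
rewrite affine5_hilbertE coef_sum.
elim: (normal_words 5) => [|w V IHV]; first by rewrite big_nil.
by rewrite big_cons IHV coefXn /= PoszD eq_sym; case: eqP.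
Qed.

Lemma affine5_hilbert_expand : affine5_hilbert = affine5_hilbert_expanded.
Proof. by rewrite /affine5_hilbert /affine5_hilbert_expanded; ring. Qed.

End Hilbert.

Theorem theorem6p15 (R : realType) :
  presented (nichols_gen (affine5 R[i])) (affine5_rels R[i]) /\
  lbasis (fun _ => True) (row_products (affine5 R[i]) affine5_rows) /\
  hilbert_poly (affine5 R[i]) affine5_hilbert /\
  affine5_hilbert = affine5_hilbert_expanded /\
  has_dim (fun _ : nichols (affine5 R[i]) => True) 1280 /\
  top_degree (affine5 R[i]) 16 /\
  integral (gen_prod (affine5 R[i])
    [:: 0; 1; 0; 1; 2; 0; 1; 0; 2; 0; 3; 0; 3; 1; 2; 4]).
Proof.
rewrite -/integral_word.
set c := affine5 R[i]; set omega := gen_prod c integral_word.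
have omega16 : @nichols_comp _ _ c 16 omega.
  exists (word R[i] integral_word); last exact: gen_prodE.
  exact: (homog_word integral_word).
have omega_neq0 : omega <> 0.
  by rewrite /omega gen_prodE => /nichols_pi0; apply/negP/normal_word_notin_ker;
    exact: integral_word_normal.
have top16 : top_degree c 16.
  split=> [|m a m16]; first by exists omega.
  have := affine5_comp_basis R[i] m; rewrite (_ : filter _ _ = [::]).
    by case=> _ span _ /span[k ->]; rewrite big_ord0.
  apply/eqP; rewrite -[_ == _]negbK -has_filter -all_predC.
  have /andP[_] := normal_words_size; apply: sub_all => w w16 /=.
  by rewrite ltn_eqF // (leq_ltn_trans w16).
split; first exact: affine5_presented.
split; first exact: affine5_basis.
split=> [n|].
  exists (count (fun w => size w == n) (normal_words 5)).
    exists [seq gen_prod c w | w <- normal_words 5 & size w == n].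
      exact: affine5_comp_basis.
    by rewrite size_map size_filter.
  exact: coef_affine5_hilbert.
split; first exact: affine5_hilbert_expand.
split.
  exists (row_products c affine5_rows); first exact: affine5_basis.
  rewrite row_productsE size_map; apply/eqP.
  by have /andP[] := normal_words_size.
by split=> //; exists 16%N.
Qed.
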